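(* For $\lambda=(\lambda_1,\lambda_2,\dots)\in\mathcal P^+$ and $x=e,f,\psi^+,\psi^-$ set $$x(z)|\lambda\rangle=\lim_{N\to\infty}x^{[N]}(z)|\lambda_1,\dots,\lambda_N\rangle,$$ where the right hand side is considered as an element of $\mathcal F(u)$ via $\mathcal F(u)=\lim_{N\to\infty}W^{N,+}(u)$. This formula endows $\mathcal F(u)$ with the structure of an $\mathcal E$-module of level $(1,q_2)$.
   Context: Parameters: $q_1,q_2,q_3\in\mathbb C^\times$ with $q_i\ne1$, $q_1q_2q_3=1$, and generic: $q_1^nq_3^m=1$ with $n,m\in\mathbb Z$ only if $n=m=0$; $u\in\mathbb C^\times$. The algebra $\mathcal E$. Put $g(z,w)=(z-q_1w)(z-q_2w)(z-q_3w)$. $\mathcal E$ is the unital associative $\mathbb C$-algebra generated by $e_i,f_i$ ($i\in\mathbb Z$), $\psi^+_j,\psi^-_{-j}$ ($j>0$) and $(\psi_0^{\pm})^{\pm1}$. With $e(z)=\sum_{i\in\mathbb Z}e_iz^{-i}$, $f(z)=\sum_{i\in\mathbb Z}f_iz^{-i}$, $\psi^\pm(z)=\sum_{\pm i\ge0}\psi^\pm_iz^{-i}$, $\delta(z)=\sum_{n\in\mathbb Z}z^n$, the defining relations (understood coefficientwise) are $$g(z,w)e(z)e(w)=-g(w,z)e(w)e(z),\quad g(w,z)f(z)f(w)=-g(z,w)f(w)f(z),$$ $$g(z,w)\psi^\pm(z)e(w)=-g(w,z)e(w)\psi^\pm(z),\quad g(w,z)\psi^\pm(z)f(w)=-g(z,w)f(w)\psi^\pm(z),$$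 $$[e(z),f(w)]=\frac{\delta(z/w)}{g(1,1)}(\psi^+(z)-\psi^-(z)),\quad [\psi^\pm_i,\psi^\pm_j]=0,\ [\psi^\pm_i,\psi^\mp_j]=0,$$ $$\psi^\pm_0(\psi^\pm_0)^{-1}=(\psi^\pm_0)^{-1}\psi^\pm_0=1,\quad [e_0,[e_1,e_{-1}]]=0,\quad [f_0,[f_1,f_{-1}]]=0.$$ A module has level $(l_+,l_-)$ if $\psi_0^\pm$ act by the scalars $l_\pm$. The modules $W^N(u)$. Let $\mathcal P^N=\{\lambda\in\mathbb Z^N\mid\lambda_1\ge\dots\ge\lambda_N\}$ and let $W^N(u)$ have basis $|\lambda\rangle$, $\lambda\in\mathcal P^N$. It is an $\mathcal E$-module with action, where $\lambda\pm\mathbf 1_i=(\lambda_1,\dots,\lambda_i\pm1,\dots,\lambda_N)$, $$(1-q_1)e(z)|\lambda\rangle=\sum_{i=1}^N\prod_{j=1}^{i-1}\frac{(1-q_1^{\lambda_i-\lambda_j}q_3^{i-j-1})(1-q_1^{\lambda_i-\lambda_j+1}q_3^{i-j+1})}{(1-q_1^{\lambda_i-\lambda_j}q_3^{i-j})(1-q_1^{\lambda_i-\lambda_j+1}q_3^{i-j})}\delta(q_1^{\lambda_i}q_3^{i-1}u/z)|\lambda+\mathbf 1_i\rangle,$$ $$-(1-q_1^{-1})f(z)|\lambda\rangle=\sum_{i=1}^N\prod_{j=i+1}^N\frac{(1-q_1^{\lambda_j-\lambda_i+1}q_3^{j-i+1})(1-q_1^{\lambda_j-\lambda_i}q_3^{j-i-1})}{(1-q_1^{\lambda_j-\lambda_i+1}q_3^{j-i})(1-q_1^{\lambda_j-\lambda_i}q_3^{j-i})}\delta(q_1^{\lambda_i-1}q_3^{i-1}u/z)|\lambda-\mathbf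 1_i\rangle,$$ $$\psi^\pm(z)|\lambda\rangle=\Big(\prod_{i=1}^N\frac{(1-q_1^{\lambda_i}q_3^{i}u/z)(1-q_1^{\lambda_i-1}q_3^{i-2}u/z)}{(1-q_1^{\lambda_i}q_3^{i-1}u/z)(1-q_1^{\lambda_i-1}q_3^{i-1}u/z)}\Big)^\pm|\lambda\rangle,$$ where $\gamma(z)^\pm$ is the expansion of the rational function $\gamma(z)$ as a power series in $z^{\mp1}$, and terms with $\lambda\pm\mathbf 1_i\notin\mathcal P^N$ are absent (their coefficients vanish). Modified operators on $W^N(u)$: let $\beta_N(z)=\frac{1-q_2q_3^Nu/z}{1-q_3^Nu/z}$ and $$e^{[N]}(z)=e(z),\quad f^{[N]}(z)=\beta_N(z)f(z),\quad \psi^{+[N]}(z)=\beta_N(z)\psi^+(z),\quad \psi^{-[N]}(z)=q_2\frac{1-q_2^{-1}q_3^{-N}z/u}{1-q_3^{-N}z/u}\psi^-(z).$$ In $f^{[N]}$ each delta function in $f(z)$ is multiplied by the value of $\beta_N$ at its support; in $\psi^{\pm[N]}$ the factors are expanded in powers of $z^{\mp1}$. Fock space: $\mathcal P^{N,+}=\{\lambda\in\mathcal P^N\mid\lambda_N\ge0\}$, $W^{N,+}(u)=\mathrm{span}\{|\lambda\rangle\mid\lambda\in\mathcal P^{N,+}\}$, with embeddings $\tau_N:W^{N,+}(u)\hookrightarrow W^{N+1,+}(u)$, $|\lambda_1,\dots,\lambda_N\rangle\mapsto|\lambda_1,\dots,\lambda_N,0\rangle$, and $\mathcal F(u)=\lim_{N\to\infty}W^{N,+}(u)$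 (inductive limit). It has basis $|\lambda\rangle$, $\lambda\in\mathcal P^+$, the set of infinite sequences of integers $\lambda_1\ge\lambda_2\ge\cdots$ with $\lambda_i=0$ for large $i$. The limit in the claim means the value for all sufficiently large $N$, these values being compatible with the embeddings. *)

(* Defs.v *)
From HB Require Import structures.
From mathcomp Require Import all_boot all_order all_algebra.
From mathcomp Require Import fraction generic_quotient.
From mathcomp Require Import finmap.
From mathcomp Require Import boolp classical_sets reals.
From mathcomp Require Import complex.
From mathcomp.multinomials Require Import monalg.

Set Implicit Arguments.
Unset Strict Implicit.
Unset Printing Implicit Defensive.

Import Order.TTheory GRing.Theory Num.Theory.
Local Open Scope ring_scope.
Local Open Scope quotient_scope.

Section QuotientAlgebra.
Variables (K : fieldType) (A : algType K) (rel : A -> A -> Prop).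

Inductive rel_ideal : A -> Prop :=
| rel_ideal_gen a x y b : rel x y -> rel_ideal (a * (x - y) * b)
| rel_ideal_0 : rel_ideal 0
| rel_ideal_D x y : rel_ideal x -> rel_ideal y -> rel_ideal (x + y).

Lemma rel_idealMl a x : rel_ideal x -> rel_ideal (a * x).
Proof.
elim=> [c y z b r| |y z _ hy _ hz].
- by rewrite !mulrA; exact: rel_ideal_gen.
- by rewrite mulr0; exact: rel_ideal_0.
- by rewrite mulrDr; exact: rel_ideal_D.
Qed.

Lemma rel_idealMr a x : rel_ideal x -> rel_ideal (x * a).
Proof.
elim=> [c y z b r| |y z _ hy _ hz].
- by rewrite -mulrA; exact: rel_ideal_gen.
- by rewrite mul0r; exact: rel_ideal_0.
- by rewrite mulrDl; exact: rel_ideal_D.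
Qed.

Lemma rel_idealZ k x : rel_ideal x -> rel_ideal (k *: x).
Proof. by move=> /(rel_idealMl k%:A); rewrite -scalerAl mul1r. Qed.

Lemma rel_idealN x : rel_ideal x -> rel_ideal (- x).
Proof. by rewrite -scaleN1r; exact: rel_idealZ. Qed.

Definition quot_eq (x y : A) : bool := `[< rel_ideal (x - y) >].

Lemma quot_eq_refl : reflexive quot_eq.
Proof. by move=> x; apply/asboolP; rewrite subrr; exact: rel_ideal_0. Qed.

Lemma quot_eq_sym : symmetric quot_eq.
Proof.
move=> x y; apply/asboolP/asboolP => /rel_idealN; by rewrite opprB.
Qed.

Lemma quot_eq_trans : transitive quot_eq.
Proof.
move=> y x z /asboolP xy /asboolP yz; apply/asboolP.
by rewrite -(subrKA y x); exact: rel_ideal_D.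
Qed.

Canonical quot_equiv := EquivRel quot_eq quot_eq_refl quot_eq_sym quot_eq_trans.

(* Properness is only needed for [1 != 0], which [algType] requires. *)
Definition quot_alg of ~ rel_ideal 1 := {eq_quot quot_equiv}.

Variable proper : ~ rel_ideal 1.
Local Notation Q := (quot_alg proper).

HB.instance Definition _ := Choice.on Q.

Definition quot_pi (x : A) : Q := \pi_({eq_quot quot_equiv}) x.
Definition quot_repr (x : Q) : A := repr (x : {eq_quot quot_equiv}).

Lemma quot_reprK : cancel quot_repr quot_pi.
Proof. exact: reprK. Qed.

Lemma quot_piP x y : quot_pi x = quot_pi y <-> rel_ideal (x - y).
Proof.
split=> [h|h]; first by apply/asboolP; apply/(eqmodP quot_equiv).
by apply/(eqmodP quot_equiv); apply/asboolP.
Qed.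

Lemma repr_quot_pi x : rel_ideal (quot_repr (quot_pi x) - x).
Proof. by apply/quot_piP; rewrite quot_reprK. Qed.

Let qadd (x y : Q) := quot_pi (quot_repr x + quot_repr y).
Let qopp (x : Q) := quot_pi (- quot_repr x).
Let qmul (x y : Q) := quot_pi (quot_repr x * quot_repr y).
Let qscale k (x : Q) := quot_pi (k *: quot_repr x).

Let qaddE x y : qadd (quot_pi x) (quot_pi y) = quot_pi (x + y).
Proof.
apply/quot_piP; rewrite opprD addrACA.
by apply: rel_ideal_D; exact: repr_quot_pi.
Qed.

Let qoppE x : qopp (quot_pi x) = quot_pi (- x).
Proof. by apply/quot_piP; rewrite -opprD; apply/rel_idealN/repr_quot_pi. Qed.

Let qmulE x y : qmul (quot_pi x) (quot_pi y) = quot_pi (x * y).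
Proof.
apply/quot_piP; set x' := quot_repr _; set y' := quot_repr _.
rewrite -(subrKA (x * y')) -mulrBl -mulrBr.
apply: rel_ideal_D; first exact/rel_idealMr/repr_quot_pi.
exact/rel_idealMl/repr_quot_pi.
Qed.

Let qscaleE k x : qscale k (quot_pi x) = quot_pi (k *: x).
Proof. by apply/quot_piP; rewrite -scalerBr; apply/rel_idealZ/repr_quot_pi. Qed.

Let piW (P : Q -> Prop) : (forall x, P (quot_pi x)) -> forall x, P x.
Proof. by move=> h x; rewrite -[x]quot_reprK. Qed.

Let qaddA : associative qadd.
Proof. by elim/piW=> x; elim/piW=> y; elim/piW=> z; rewrite !qaddE addrA. Qed.
Let qaddC : commutative qadd.
Proof. by elim/piW=> x; elim/piW=> y; rewrite !qaddE addrC. Qed.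
Let qadd0 : left_id (quot_pi 0) qadd.
Proof. by elim/piW=> x; rewrite qaddE add0r. Qed.
Let qaddN : left_inverse (quot_pi 0) qopp qadd.
Proof. by elim/piW=> x; rewrite qoppE qaddE addNr. Qed.

HB.instance Definition _ := GRing.isZmodule.Build Q qaddA qaddC qadd0 qaddN.

Let qmulA : associative qmul.
Proof. by elim/piW=> x; elim/piW=> y; elim/piW=> z; rewrite !qmulE mulrA. Qed.
Let qmul1x : left_id (quot_pi 1) qmul.
Proof. by elim/piW=> x; rewrite qmulE mul1r. Qed.
Let qmulx1 : right_id (quot_pi 1) qmul.
Proof. by elim/piW=> x; rewrite qmulE mulr1. Qed.
Let qmulDl : left_distributive qmul qadd.
Proof.
by elim/piW=> x; elim/piW=> y; elim/piW=> z; rewrite !(qaddE, qmulE) mulrDl.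
Qed.
Let qmulDr : right_distributive qmul qadd.
Proof.
by elim/piW=> x; elim/piW=> y; elim/piW=> z; rewrite !(qaddE, qmulE) mulrDr.
Qed.
Let qone_neq0 : quot_pi 1 != quot_pi 0.
Proof. by apply/eqP => /quot_piP; rewrite subr0; exact: proper. Qed.

HB.instance Definition _ :=
  GRing.Zmodule_isNzRing.Build Q qmulA qmul1x qmulx1 qmulDl qmulDr qone_neq0.

Let qscaleA a b x : qscale a (qscale b x) = qscale (a * b) x.
Proof. by move: x; elim/piW=> x; rewrite !qscaleE scalerA. Qed.
Let qscale1 : left_id 1 qscale.
Proof. by elim/piW=> x; rewrite qscaleE scale1r. Qed.
Let qscaleDr : right_distributive qscale qadd.
Proof.
by move=> a; elim/piW=> x; elim/piW=> y; rewrite !(qaddE, qscaleE) scalerDr.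
Qed.
Let qscaleDl x a b : qscale (a + b) x = qadd (qscale a x) (qscale b x).
Proof. by move: x; elim/piW=> x; rewrite !qscaleE qaddE scalerDl. Qed.

HB.instance Definition _ :=
  GRing.Zmodule_isLmodule.Build K Q qscaleA qscale1 qscaleDr qscaleDl.

Let qscaleAl a (x y : Q) : a *: (x * y) = (a *: x) * y.
Proof.
move: x y; elim/piW=> x; elim/piW=> y.
by rewrite /GRing.mul /GRing.scale /= !(qmulE, qscaleE) scalerAl.
Qed.
HB.instance Definition _ := GRing.Lmodule_isLalgebra.Build K Q qscaleAl.

Let qscaleAr a (x y : Q) : a *: (x * y) = x * (a *: y).
Proof.
move: x y; elim/piW=> x; elim/piW=> y.
by rewrite /GRing.mul /GRing.scale /= !(qmulE, qscaleE) scalerAr.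
Qed.
HB.instance Definition _ := GRing.Lalgebra_isAlgebra.Build K Q qscaleAr.

Lemma quot_pi_is_linear : linear quot_pi.
Proof. by move=> a x y; rewrite -qaddE -qscaleE. Qed.
HB.instance Definition _ := GRing.isLinear.Build K A Q _ quot_pi quot_pi_is_linear.

Lemma quot_pi_is_monoid_morphism : monoid_morphism quot_pi.
Proof. by split=> // x y; rewrite -qmulE. Qed.
HB.instance Definition _ :=
  GRing.isMonoidMorphism.Build A Q quot_pi quot_pi_is_monoid_morphism.

End QuotientAlgebra.

Record is_module (K : fieldType) (A : algType K) (V : lmodType K)
    (rho : A -> V -> V) : Prop := IsModule {
  module_linear_l : forall v, linear (rho^~ v);
  module_linear_r : forall a, linear (rho a);
  module_1 : forall v, rho 1 v = v;
  module_M : forall a b v, rho (a * b) v = rho a (rho b v)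
}.

Inductive gen : Type :=
| gen_e of int
| gen_f of int
| gen_psip of nat    (* [gen_psip j] is psi^+_j *)
| gen_psim of nat    (* [gen_psim j] is psi^-_{-j} *)
| gen_psip0V         (* (psi^+_0)^{-1} *)
| gen_psim0V.        (* (psi^-_0)^{-1} *)

HB.instance Definition _ := gen_eqMixin gen.
HB.instance Definition _ := gen_choiceMixin gen.

Definition free_alg (K : fieldType) := {malg K[{fmonom gen}]}.

HB.instance Definition _ (K : fieldType) := GRing.Lalgebra.on (free_alg K).

Lemma malg_scaleAr (M : monomType) (K : fieldType) (a : K) (x y : {malg K[M]}) :
  a *: (x * y) = x * (a *: y).
Proof.
apply/malgP => k; rewrite mcoeffZ mcoeffMl.
rewrite (mcoeffMlw _ (fsubset_refl _) (msuppZ_le a y)) mulr_sumr.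
apply: eq_bigr => i _; rewrite mulr_sumr; apply: eq_bigr => j _.
by rewrite mcoeffZ mulrnAr mulrCA.
Qed.

HB.instance Definition _ (K : fieldType) :=
  GRing.Lalgebra_isAlgebra.Build K (free_alg K) (@malg_scaleAr _ K).

Definition gfun (R : comNzRingType) (q1 q2 q3 z w : R) : R :=
  (z - q1 * w) * (z - q2 * w) * (z - q3 * w).

Definition comm (A : nzRingType) (x y : A) : A := x * y - y * x.

(* Coefficient of [z^{-m} w^{-n}] in [p(z, w) X(z, w)], where [p`_a`_b] is the
   coefficient of [z^a w^b] in [p] and [X i j] that of [z^{-i} w^{-j}] in [X]. *)
Definition smul (K : fieldType) (V : lmodType K) (p : {poly {poly K}})
    (X : int -> int -> V) (m n : int) : V :=
  \sum_(a < size p) \sum_(b < size p`_a)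
    p`_a`_b *: X (m + a%:Z) (n + b%:Z).

Section AlgebraE.
Variables (K : fieldType) (q1 q2 q3 : K).

Definition gpoly (z w : {poly {poly K}}) : {poly {poly K}} :=
  gfun q1%:P%:P q2%:P%:P q3%:P%:P z w.
Definition g_zw : {poly {poly K}} := gpoly 'X 'X%:P.
Definition g_wz : {poly {poly K}} := gpoly 'X%:P 'X.

Definition fgen (x : gen) : free_alg K := << fmu x >>.

Definition fe (i : int) : free_alg K := fgen (gen_e i).
Definition ff (i : int) : free_alg K := fgen (gen_f i).
Definition fpsip (i : int) : free_alg K :=
  if 0 <= i then fgen (gen_psip `|i|%N) else 0.
Definition fpsim (i : int) : free_alg K :=
  if i <= 0 then fgen (gen_psim `|i|%N) else 0.

(* The signs [+] and [-] are encoded as [true] and [false]. *)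
Definition fpsi (s : bool) : int -> free_alg K := if s then fpsip else fpsim.
Definition fpsi0V (s : bool) : free_alg K :=
  fgen (if s then gen_psip0V else gen_psim0V).

Inductive E_rel : free_alg K -> free_alg K -> Prop :=
| E_rel_ee m n :
    E_rel (smul g_zw (fun i j => fe i * fe j) m n)
          (- smul g_wz (fun i j => fe j * fe i) m n)
| E_rel_ff m n :
    E_rel (smul g_wz (fun i j => ff i * ff j) m n)
          (- smul g_zw (fun i j => ff j * ff i) m n)
| E_rel_psie s m n :
    E_rel (smul g_zw (fun i j => fpsi s i * fe j) m n)
          (- smul g_wz (fun i j => fe j * fpsi s i) m n)
| E_rel_psif s m n :
    E_rel (smul g_wz (fun i j => fpsi s i * ff j) m n)
          (- smul g_zw (fun i j => ff j * fpsi s i) m n)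
| E_rel_ef m n :
    E_rel (comm (fe m) (ff n))
          ((gfun q1 q2 q3 1 1)^-1 *: (fpsip (m + n) - fpsim (m + n)))
| E_rel_psipsi s t i j : E_rel (comm (fpsi s i) (fpsi t j)) 0
| E_rel_psi0V s : E_rel (fpsi s 0 * fpsi0V s) 1
| E_rel_psiV0 s : E_rel (fpsi0V s * fpsi s 0) 1
| E_rel_eee : E_rel (comm (fe 0) (comm (fe 1) (fe (-1)))) 0
| E_rel_fff : E_rel (comm (ff 0) (comm (ff 1) (ff (-1)))) 0.

(* The relations are consistent: they hold for the character of the free algebra
   which sends the series [e] and [f] to 0 and [psi^+], [psi^-] to 1. *)
Definition counit_gen (x : gen) : K :=
  match x with
  | gen_e _ | gen_f _ => 0
  | gen_psip j | gen_psim j => (j == 0%N)%:R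
  | gen_psip0V | gen_psim0V => 1
  end.

Definition counit_monom (m : {fmonom gen}) : K := \prod_(x <- m) counit_gen x.

Lemma counit_monomP : mmorphism counit_monom.
Proof.
split=> [x y|]; first by rewrite /counit_monom fmM big_cat.
by rewrite /counit_monom fm1 big_nil.
Qed.
HB.instance Definition _ :=
  isMultiplicative.Build {fmonom gen} K counit_monom counit_monomP.

Definition counit : {lrmorphism free_alg K -> K | *%R} :=
  GRing.LRMorphism.clone K {malg K[{fmonom gen}]} K _ (mmap idfun counit_monom) _.

Lemma counit_fgen x : counit (fgen x) = counit_gen x.
Proof. by rewrite /counit /= mmapU /= mul1r /counit_monom fmU big_seq1. Qed.

Lemma counitZ a x : counit (a *: x) = a * counit x.
Proof. exact: linearZ. Qed.

Lemma counit_smul p (X : int -> int -> free_alg K) m n :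
  (forall i j, counit (X i j) = 0) -> counit (smul p X m n) = 0.
Proof.
move=> h; rewrite /smul (raddf_sum counit) big1 // => a _.
rewrite (raddf_sum counit) big1 // => b _.
by apply: etrans (counitZ _ _) _; rewrite h mulr0.
Qed.

Lemma counitN x : counit (- x) = - counit x.
Proof. exact: raddfN. Qed.

Lemma counitD x y : counit (x + y) = counit x + counit y.
Proof. exact: raddfD. Qed.

Lemma counitB x y : counit (x - y) = counit x - counit y.
Proof. exact: raddfB. Qed.

Lemma counitM x y : counit (x * y) = counit x * counit y.
Proof. exact: rmorphM. Qed.

Lemma counit0 : counit 0 = 0.
Proof. exact: raddf0. Qed.

Lemma counit1 : counit 1 = 1.
Proof. exact: rmorph1. Qed.

Lemma counit_comm x y : counit (comm x y) = 0.
Proof.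
apply: etrans (counitB (x * y) (y * x)) _.
apply/eqP; rewrite subr_eq0; apply/eqP.
apply: etrans (counitM x y) _; apply: etrans (mulrC _ _) _.
exact/esym/counitM.
Qed.

Lemma counitMl x y : counit x = 0 -> counit (x * y) = 0.
Proof. by move=> h; apply: etrans (counitM x y) _; rewrite h mul0r. Qed.

Lemma counitMr x y : counit y = 0 -> counit (x * y) = 0.
Proof. by move=> h; apply: etrans (counitM x y) _; rewrite h mulr0. Qed.

Lemma counit_smul_eq p p' (X Y : int -> int -> free_alg K) m n :
  (forall i j, counit (X i j) = 0) -> (forall i j, counit (Y i j) = 0) ->
  counit (smul p X m n) = counit (- smul p' Y m n).
Proof.
move=> hX hY; rewrite (counit_smul p m n hX).
by apply/esym/(etrans (counitN _)); rewrite (counit_smul p' m n hY) oppr0.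
Qed.

Lemma counit_rel x y : E_rel x y -> counit x = counit y.
Proof.
have e0 i : counit (fe i) = 0 by rewrite counit_fgen.
have f0 i : counit (ff i) = 0 by rewrite counit_fgen.
have psi0 s i : counit (fpsi s i) = (i == 0)%:R.
  by case: s; rewrite /fpsi ?/fpsip ?/fpsim; case: ifP => h;
    rewrite ?counit_fgen /= ?absz_eq0 // counit0; case: eqP h => // ->.
have psiV s : counit (fpsi0V s) = 1 by rewrite counit_fgen; case: s.
case=> [m n|m n|s m n|s m n|m n|s t i j|s|s||].
- by apply: counit_smul_eq => i j; apply: counitMl.
- by apply: counit_smul_eq => i j; apply: counitMl.
- by apply: counit_smul_eq => i j; [apply: counitMr|apply: counitMl].
- by apply: counit_smul_eq => i j; [apply: counitMr|apply: counitMl].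
- rewrite counit_comm counitZ counitB.
  by rewrite -[fpsip]/(fpsi true) -[fpsim]/(fpsi false) !psi0 subrr mulr0.
- by rewrite counit_comm counit0.
- by rewrite counitM psi0 psiV counit1 mulr1.
- by rewrite counitM psi0 psiV counit1 mulr1.
- by rewrite counit_comm counit0.
- by rewrite counit_comm counit0.
Qed.

Lemma E_rel_proper : ~ rel_ideal E_rel 1.
Proof.
suff h x : rel_ideal E_rel x -> counit x = 0.
  by move/h; rewrite counit1; apply/eqP; rewrite oner_eq0.
elim=> [a y z b /counit_rel yz||y z _ hy _ hz]; last 2 first.
- exact: counit0.
- by rewrite counitD hy hz addr0.
by rewrite !counitM counitB yz subrr mulr0 mul0r.
Qed.

Definition algE := quot_alg E_rel_proper.
HB.instance Definition _ := GRing.Algebra.on algE.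

Definition E_pi : free_alg K -> algE := quot_pi E_rel_proper.
Definition E_e (i : int) : algE := E_pi (fe i).
Definition E_f (i : int) : algE := E_pi (ff i).
Definition E_psip (i : int) : algE := E_pi (fpsip i).
Definition E_psim (i : int) : algE := E_pi (fpsim i).

Definition has_level (V : lmodType K) (rho : algE -> V -> V) (lp lm : K) : Prop :=
  (forall v, rho (E_psip 0) v = lp *: v) /\ (forall v, rho (E_psim 0) v = lm *: v).

End AlgebraE.

(* Weights [lambda_1, lambda_2, ...] are indexed from 0 below. *)

Definition dominant (N : nat) (lam : {ffun 'I_N -> int}) : bool :=
  [forall i : 'I_N, forall j : 'I_N, (i <= j)%N ==> (lam j <= lam i)].

Definition PN (N : nat) := {lam : {ffun 'I_N -> int} | dominant lam}.

Definition nonneg (N : nat) (lam : PN N) : bool :=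
  [forall i : 'I_N, (i.+1 == N) ==> (0 <= val lam i)].

Definition PNplus (N : nat) := {lam : PN N | nonneg lam}.

Record Pplus := MkPplus {
  pfun :> nat -> int;
  pfun_noninc : forall i j, (i <= j)%N -> pfun j <= pfun i;
  pfun_fin : exists l, forall i, (l <= i)%N -> pfun i = 0
}.

HB.instance Definition _ := gen_eqMixin Pplus.
HB.instance Definition _ := gen_choiceMixin Pplus.

Lemma trunc_dominant (N : nat) (lam : Pplus) : dominant [ffun i : 'I_N => lam i].
Proof.
apply/forallP => i; apply/forallP => j; apply/implyP => ij.
by rewrite !ffunE; exact: pfun_noninc.
Qed.
Definition trunc (N : nat) (lam : Pplus) : PN N := Sub _ (trunc_dominant N lam).

Definition pad (N : nat) (lam : {ffun 'I_N -> int}) (i : nat) : int :=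
  oapp lam 0 (insub i).

Lemma padE N (lam : {ffun 'I_N -> int}) (i : 'I_N) : pad lam i = lam i.
Proof. by rewrite /pad valK. Qed.

Lemma pad_out N (lam : {ffun 'I_N -> int}) i : (N <= i)%N -> pad lam i = 0.
Proof. by move=> h; rewrite /pad insubN // -leqNgt. Qed.

Lemma nonneg_ge0 N (lam : PNplus N) (i : 'I_N) : 0 <= val (val lam) i.
Proof.
case: N lam i => [|N] lam i; first by case: i.
have /forallP/(_ ord_max)/implyP/(_ (eqxx _)) h := valP lam.
have /forallP/(_ i)/forallP/(_ ord_max)/implyP := valP (val lam).
by move/(_ (leq_ord i)); exact: le_trans.
Qed.

Lemma pad_noninc N (lam : PNplus N) i j :
  (i <= j)%N -> pad (val (val lam)) j <= pad (val (val lam)) i.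
Proof.
move=> ij; have [jN|Nj] := ltnP j N.
  have iN := leq_ltn_trans ij jN.
  rewrite (padE _ (Ordinal jN)) (padE _ (Ordinal iN)).
  by have /forallP/(_ (Ordinal iN))/forallP/(_ (Ordinal jN))/implyP := valP (val lam); apply.
rewrite (pad_out _ Nj); have [iN|Ni] := ltnP i N; last by rewrite pad_out.
by rewrite (padE _ (Ordinal iN)) nonneg_ge0.
Qed.

Lemma pad_fin N (lam : PNplus N) :
  exists l, forall i, (l <= i)%N -> pad (val (val lam)) i = 0.
Proof. by exists N => i; exact: pad_out. Qed.

Definition extend (N : nat) (lam : PNplus N) : Pplus :=
  MkPplus (@pad_noninc N lam) (pad_fin lam).

Lemma pfun_inj : injective pfun.
Proof.
case=> a a1 a2 [b b1 b2] /= e; case: _ / e in b1 b2 *.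
by congr MkPplus; exact: Prop_irrelevance.
Qed.

Lemma extend_inj N : injective (@extend N).
Proof.
move=> lam mu /(congr1 pfun) /= e; apply/val_inj/val_inj/ffunP => i.
by rewrite -!padE e.
Qed.

Lemma pfun_ge0 (lam : Pplus) i : 0 <= lam i.
Proof.
have [l hl] := pfun_fin lam; rewrite -(hl _ (leq_maxr i l)).
exact/pfun_noninc/leq_maxl.
Qed.

Lemma extend_surj (lam : Pplus) N :
  (forall i, (N <= i)%N -> lam i = 0) -> exists mu : PNplus N, extend mu = lam.
Proof.
move=> lam0; have nn : nonneg (trunc N lam).
  by apply/forallP => i; apply/implyP => _; rewrite SubK ffunE pfun_ge0.
exists (Sub _ nn); apply/pfun_inj/funext => i /=.
have [iN|Ni] := ltnP i N; last by rewrite pad_out ?lam0.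
by rewrite (padE _ (Ordinal iN)) ffunE.
Qed.

Lemma append0_dominant N (lam : PNplus N) :
  dominant [ffun i : 'I_N.+1 => pad (val (val lam)) i].
Proof.
apply/forallP => i; apply/forallP => j; apply/implyP => ij.
by rewrite !ffunE; exact: pad_noninc.
Qed.

Lemma append0_nonneg N (lam : PNplus N) :
  nonneg (Sub _ (append0_dominant lam) : PN N.+1).
Proof.
apply/forallP => i; apply/implyP => /eqP [iN].
by rewrite SubK ffunE pad_out ?iN.
Qed.

(* (lambda_1, ..., lambda_N) |-> (lambda_1, ..., lambda_N, 0) *)
Definition append0 N (lam : PNplus N) : PNplus N.+1 := Sub _ (append0_nonneg lam).

Lemma extend_append0 N (lam : PNplus N) : extend (append0 lam) = extend lam.
Proof.
apply/pfun_inj/funext => i /=; have [iN|Ni] := ltnP i N.+1.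
  by rewrite (padE _ (Ordinal iN)) ffunE.
by rewrite !pad_out // ltnW.
Qed.

Section FockSpace.
Variable K : fieldType.

Definition W (N : nat) := {malg K[PN N]}.
Definition Wplus (N : nat) := {malg K[PNplus N]}.
Definition fock := {malg K[Pplus]}.

HB.instance Definition _ N := GRing.Lmodule.on (W N).
HB.instance Definition _ N := GRing.Lmodule.on (Wplus N).
HB.instance Definition _ := GRing.Lmodule.on fock.

Section Linext.
Variables (T : choiceType) (V : lmodType K) (h : T -> V).

Definition linext (x : {malg K[T]}) : V := \sum_(t <- msupp x) x@_t *: h t.

Lemma linextEw (d : {fset T}) x :
  fsubset (msupp x) d -> linext x = \sum_(t <- d) x@_t *: h t.
Proof.
move=> le; rewrite [LHS](big_fset_incl _ le) => //= t _ /mcoeff_outdom ->.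
by rewrite scale0r.
Qed.

Lemma linext_ket t : linext << t >> = h t.
Proof. by rewrite (linextEw msuppU_le) big_seq_fset1 mcoeffUU scale1r. Qed.

Lemma linext_linear : linear linext.
Proof.
move=> a x y; set d := (msupp x `|` msupp y)%fset.
rewrite (@linextEw d x) ?fsubsetUl // (@linextEw d y) ?fsubsetUr //.
rewrite (@linextEw d); last first.
  apply: fsubset_trans (msuppD_le _ _) _; apply: fsetUSS => //.
  exact: msuppZ_le.
rewrite scaler_sumr -big_split /=; apply: eq_bigr => t _.
by rewrite mcoeffD mcoeffZ scalerDl scalerA.
Qed.

HB.instance Definition _ :=
  GRing.isLinear.Build K {malg K[T]} V _ linext linext_linear.

End Linext.

Definition Wplus_incl (N : nat) : Wplus N -> W N :=
  linext (fun lam => << val lam >> : W N).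
Definition tau (N : nat) : Wplus N -> Wplus N.+1 :=
  linext (fun lam => << append0 lam >> : Wplus N.+1).
Definition to_fock (N : nat) : Wplus N -> fock :=
  linext (fun lam => << extend lam >> : fock).

(* [fock], with the maps [to_fock N], is the inductive limit of the spaces
   [Wplus N] along the embeddings [tau N]. *)
Lemma to_fock_tau N (w : Wplus N) : to_fock (tau w) = to_fock w.
Proof.
rewrite /tau {1}/linext /to_fock raddf_sum /=; apply: eq_bigr => t _.
by apply: etrans (linearZ _ _) _; rewrite /= linext_ket extend_append0.
Qed.

Lemma to_fock_inj N : injective (@to_fock N).
Proof.
have coefE (w : Wplus N) lam : (to_fock w)@_(extend lam) = w@_lam.
  rewrite /to_fock /linext raddf_sum /= [w in RHS]monalgE raddf_sum /=.
  apply: eq_bigr => t _.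
  by rewrite mcoeffZ !mcoeffU (inj_eq (@extend_inj N)) mulr_natr.
by move=> v w e; apply/malgP => lam; rewrite -!coefE e.
Qed.

Lemma to_fock_exhaust (v : fock) : exists N (w : Wplus N), to_fock w = v.
Proof.
suff [N /(_ N (leqnn N)) [w e]] :
  exists N0, forall N, (N0 <= N)%N -> exists w : Wplus N, to_fock w = v.
  by exists N, w.
rewrite [v]monalgE; elim/big_ind: _ => [|x y [N1 h1] [N2 h2]|lam _].
- by exists 0%N => N _; exists 0; exact: raddf0.
- exists (maxn N1 N2) => N; rewrite geq_max => /andP[/h1 [w1 <-] /h2 [w2 <-]].
  by exists (w1 + w2); exact: raddfD.
have [l hl] := pfun_fin lam; exists l => N lN.
have [|mu e] := @extend_surj lam N; first by move=> i /(leq_trans lN)/hl.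
exists (v@_lam *: << mu >>); apply: etrans (linearZ _ _) _.
rewrite /= linext_ket e; apply/malgP => k.
by rewrite mcoeffZ !mcoeffU mulr_natr.
Qed.

(* Stabilization of operator-valued series applied to a vector: from some [N] on,
   all coefficients of [x N] lie in [Wplus N] and coincide, in the Fock space,
   with those of [y]. *)
Definition fock_lim (x : forall N, int -> W N) (y : int -> fock) : Prop :=
  exists N0, forall N, (N0 <= N)%N -> forall n : int,
    exists2 w : Wplus N, Wplus_incl w = x N n & to_fock w = y n.

End FockSpace.

Section Expansion.
Variable K : fieldType.

Definition ratfun := {fraction {poly K}}.
HB.instance Definition _ := GRing.Field.on ratfun.
Definition cst (c : K) : ratfun := tofrac c%:P.
Definition zvar : ratfun := tofrac 'X.

(* [a] is the power series expansion of the rational function [r] at 0. *)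
Definition expands (r : ratfun) (a : nat -> K) : Prop :=
  exists p q : {poly K},
    [/\ q`_0 != 0, r = tofrac p / tofrac q
      & forall n, \sum_(k < n.+1) q`_k * a (n - k)%N = p`_n].

Definition expansion (r : ratfun) : nat -> K := xget (fun=> 0) [set a | expands r a].

(* For [h(z)] given as a function of the variable: coefficients of [z^{-k}],
   resp. [z^k], in its expansion as a power series in [z^{-1}], resp. [z]. *)
Definition expand_pos (h : ratfun -> ratfun) : nat -> K := expansion (h (zvar^-1)).
Definition expand_neg (h : ratfun -> ratfun) : nat -> K := expansion (h zvar).

End Expansion.

(* All functions of [n : int] below give the coefficient of [z^{-n}]. *)

Section Action.
Variables (K : fieldType) (q1 q2 q3 u : K).

Definition beta (F : fieldType) (q2 q3 u : F) (N : nat) (z : F) : F :=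
  (1 - q2 * q3 ^+ N * u / z) / (1 - q3 ^+ N * u / z).

Definition beta_minus (F : fieldType) (q2 q3 u : F) (N : nat) (z : F) : F :=
  q2 * ((1 - q2^-1 * q3 ^- N * z / u) / (1 - q3 ^- N * z / u)).

Definition cfactor (l d : int) : K :=
  ((1 - q1 ^ l * q3 ^ (d - 1)) * (1 - q1 ^ (l + 1) * q3 ^ (d + 1)))
  / ((1 - q1 ^ l * q3 ^ d) * (1 - q1 ^ (l + 1) * q3 ^ d)).

Section FixedN.
Variables (N : nat) (lam : PN N).
Local Notation l := (val lam).

(* [|lambda + d 1_i>], absent (zero) if [lambda + d 1_i] is not in [PN N] *)
Definition shift (i : 'I_N) (d : int) : W K N :=
  if insub [ffun j => l j + (if j == i then d else 0)] is Some m
  then << m >> else 0.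

Definition W_e (n : int) : W K N :=
  (1 - q1)^-1 *: \sum_(i < N)
    (\prod_(j < N | (j < i)%N) cfactor (l i - l j) (i%:Z - j%:Z)
     * (q1 ^ (l i) * q3 ^+ i * u) ^ n) *: shift i 1.

(* Each delta function in [f(z)] is multiplied by the value of [beta] at its
   support. *)
Definition f_supp (i : 'I_N) : K := q1 ^ (l i - 1) * q3 ^+ i * u.

Definition f_coef (i : 'I_N) : K :=
  \prod_(j < N | (i < j)%N) cfactor (l j - l i) (j%:Z - i%:Z).

Definition W_fN (n : int) : W K N :=
  (- (1 - q1^-1))^-1 *: \sum_(i < N)
    (f_coef i * beta q2 q3 u N (f_supp i) * f_supp i ^ n) *: shift i (-1).

Definition psi_ratfun (z : ratfun K) : ratfun K :=
  \prod_(i < N)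
    (((1 - cst (q1 ^ (l i) * q3 ^ i.+1%:Z * u) / z)
      * (1 - cst (q1 ^ (l i - 1) * q3 ^ (i.+1%:Z - 2) * u) / z))
     / ((1 - cst (q1 ^ (l i) * q3 ^ (i.+1%:Z - 1) * u) / z)
        * (1 - cst (q1 ^ (l i - 1) * q3 ^ (i.+1%:Z - 1) * u) / z))).

Definition W_psip (n : int) : W K N :=
  if 0 <= n then expand_pos psi_ratfun `|n|%N *: << lam >> else 0.

Definition W_psim (n : int) : W K N :=
  if n <= 0 then expand_neg psi_ratfun `|n|%N *: << lam >> else 0.

Definition W_psipN (n : int) : W K N :=
  if 0 <= n then
    \sum_(k < `|n|%N.+1)
      expand_pos (beta (cst q2) (cst q3) (cst u) N) k *: W_psip (n - k%:Z)
  else 0.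

Definition W_psimN (n : int) : W K N :=
  if n <= 0 then
    \sum_(k < `|n|%N.+1)
      expand_neg (beta_minus (cst q2) (cst q3) (cst u) N) k *: W_psim (n + k%:Z)
  else 0.

End FixedN.
End Action.

(* Main.v *)
From HB Require Import structures.
Require Import Defs.
From mathcomp Require Import all_boot all_order all_algebra.
From mathcomp Require Import fraction finmap boolp classical_sets reals complex.
From mathcomp Require Import ring zify.
From mathcomp.multinomials Require Import monalg.

Set Implicit Arguments.
Unset Strict Implicit.
Unset Printing Implicit Defensive.

Import Order.TTheory GRing.Theory Num.Theory.
Local Open Scope ring_scope.

(** The limit operators have explicit matrix elements on kets of partitions, and
    the defining relations are verified on kets, one matrix element at a time.

    Existence of the limit. Over the empty rows, the product in the amplitude of
    [f(z)] and the product in the eigenvalue of [psi(z)] telescope, and the factor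
    [beta] compensates exactly the change caused by one more empty row
    ([beta_step], [psi_cut_stable]). The amplitude of a move that leaves the set
    of partitions vanishes ([e_allowed], [f_allowed]).

    Relations of [e(z)] with itself. Moving one of two rows multiplies their
    interaction factor by a ratio of values of the structure function [g]
    ([cfactor_step]). Exchanging two moves of different rows therefore produces
    the factor required by the quadratic relation, and two moves of the same
    row have supports at a zero of [g]. In the Serre relation, the coefficient of
    a target is a sum over the orders of three moves. The exchange relation
    expresses the six amplitudes by a single nonzero one, and the sum that remains
    is an antisymmetrization which vanishes identically ([serre_poly_antisym],
    [serre_six], [ladder_serre]). For [f(z)] the same argument applies, with the
    arguments of [g] reversed; both cases are instances of [exchange_ladder].

    Relations with [psi(z)]. The expansions of a rational function of [z] are
    sequences vanishing on one side, polynomials in [z] act on them by shifts, and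
    products of linear factors act injectively. So identities between eigenvalues
    may be checked after multiplying by all denominators ([sact_cross]), where they
    say that a new box changes the eigenvalue by a ratio of structure functions
    ([psi_ev_bump]).

    The commutator of [e(z)] and [f(z)]. Moves of different rows commute
    ([ef_commute]), so only the moves of a box back and forth remain. The two
    expansions of the eigenvalue differ by the sum over its simple poles of the
    residue times a delta function ([ratio_seriesB]). The poles of nonzero residue
    are at the ends of the rows, and the residues are proportional to the products
    of the amplitudes of adding and removing a box there ([residue_add],
    [residue_remove]). *)

(** * Cubic structure functions *)

Section Cubic.
Variable K : fieldType.

Definition cubic (s1 s2 z w : K) : K :=
  z ^+ 3 - s1 * z ^+ 2 * w + s2 * z * w ^+ 2 - w ^+ 3.

Lemma cubicC s1 s2 z w : cubic s1 s2 w z = - cubic s2 s1 z w.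
Proof. by rewrite /cubic; ring. Qed.

Lemma gfunE q1 q2 q3 z w : q1 * q2 * q3 = 1 ->
  gfun q1 q2 q3 z w = cubic (q1 + q2 + q3) (q1 * q2 + q1 * q3 + q2 * q3) z w.
Proof. by move=> q123; rewrite /gfun /cubic -[w ^+ 3]mul1r -q123; ring. Qed.

Definition serre_poly (z1 z2 z3 : K) : K :=
  z1 * z2 ^+ 2 - z1 * z3 ^+ 2 - z1 ^+ 2 * z3 + z2 ^+ 2 * z3.

(** The Serre weight divided by the product of the three structure functions has
    zero antisymmetrization. Denominators are cleared, since structure functions
    do vanish at neighbouring boxes. *)
Lemma serre_poly_antisym (s1 s2 z1 z2 z3 : K) (G := cubic s1 s2) :
  serre_poly z1 z2 z3 * (G z2 z1 * G z3 z1 * G z3 z2)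
  - serre_poly z2 z1 z3 * (G z1 z2 * G z3 z1 * G z3 z2)
  - serre_poly z1 z3 z2 * (G z2 z3 * G z2 z1 * G z3 z1)
  + serre_poly z2 z3 z1 * (G z1 z2 * G z1 z3 * G z3 z2)
  + serre_poly z3 z1 z2 * (G z2 z3 * G z1 z3 * G z2 z1)
  - serre_poly z3 z2 z1 * (G z1 z2 * G z1 z3 * G z2 z3) = 0.
Proof. rewrite /G /cubic /serre_poly; ring. Qed.

End Cubic.

(** * Partitions and kets *)

Definition supp_lt (M : nat) (f : nat -> int) := forall k, (M <= k)%N -> f k = 0.

Definition is_part (f : nat -> int) :=
  (forall i j, (i <= j)%N -> f j <= f i) /\ (exists M, supp_lt M f).

Definition cutoff (f : nat -> int) : nat := xget 0%N [set M | supp_lt M f].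

Lemma cutoffP f M : supp_lt M f -> supp_lt (cutoff f) f.
Proof. by move=> fM; exact: (@xgetPex _ 0%N [set N | supp_lt N f] (ex_intro _ M fM)). Qed.

Lemma supp_ltW M N f : (M <= N)%N -> supp_lt M f -> supp_lt N f.
Proof. by move=> MN fM k Nk; apply: fM; apply: leq_trans MN Nk. Qed.

Lemma Pplus_is_part (lam : Pplus) : is_part lam.
Proof. by split; [exact: pfun_noninc|exact: pfun_fin]. Qed.

Lemma is_part_cutoff f : is_part f -> supp_lt (cutoff f) f.
Proof. by case=> _ [M]; exact: cutoffP. Qed.

Lemma is_part_ge0 f i : is_part f -> 0 <= f i.
Proof. by case=> a b; exact: (pfun_ge0 (MkPplus a b)). Qed.

Definition bump (f : nat -> int) (i : nat) (d : int) : nat -> int :=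
  fun k => f k + (if k == i then d else 0).

Lemma bump_same f i d : bump f i d i = f i + d.
Proof. by rewrite /bump eqxx. Qed.

Lemma bump_other f i d k : k != i -> bump f i d k = f k.
Proof. by rewrite /bump => /negbTE ->; rewrite addr0. Qed.

Lemma bumpC f i j d e : bump (bump f i d) j e = bump (bump f j e) i d.
Proof. by apply/funext => k; rewrite /bump addrAC. Qed.

Lemma bumpK f i d : bump (bump f i d) i (- d) = f.
Proof.
by apply/funext => k; rewrite /bump; case: eqP => _; rewrite ?addrK ?addr0.
Qed.

Lemma bumpNK f i d : bump (bump f i (- d)) i d = f.
Proof. by have := bumpK f i (- d); rewrite opprK. Qed.

Lemma bump_supp f i d M : supp_lt M f -> (i < M)%N -> supp_lt M (bump f i d).
Proof.
move=> fM iM k Mk; rewrite bump_other ?fM //.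
by rewrite neq_ltn (leq_trans iM Mk) orbT.
Qed.

(** Below the first empty row nothing can move: a new box would break
    monotonicity, and removing one would make the row negative. *)
Lemma bump_part_lt f i d M : d = 1 \/ d = -1 -> supp_lt M f ->
  is_part (bump f i d) -> (i <= M)%N.
Proof.
move=> d1 fM pb; rewrite leqNgt; apply/negP => Mi.
case: d1 pb => -> pb.
  have := pb.1 i.-1 i (leq_pred i); rewrite bump_same bump_other; last lia.
  by rewrite !fM //; lia.
have := is_part_ge0 i pb; rewrite bump_same fM; lia.
Qed.

Lemma bump_part_supp f i d M : d = 1 \/ d = -1 -> supp_lt M f ->
  is_part (bump f i d) -> supp_lt M.+1 (bump f i d).
Proof.
move=> d1 fM pb; apply: bump_supp; first exact: supp_ltW fM.
by rewrite ltnS; exact: bump_part_lt pb.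
Qed.

Section Kets.
Variable K : fieldType.

(** Zero outside partitions, so that sums over all rows need not single out the
    moves that stay within partitions. *)
Definition ket (f : nat -> int) : fock K :=
  if pselect (is_part f) is left h then << MkPplus h.1 h.2 >> else 0.

Lemma ket_Pplus (lam : Pplus) : ket lam = << lam >>.
Proof.
rewrite /ket; case: pselect => [h|]; last by case; exact: Pplus_is_part.
by congr (<< _ >>); exact: pfun_inj.
Qed.

Lemma ket_out f : ~ is_part f -> ket f = 0.
Proof. by rewrite /ket; case: pselect. Qed.

Lemma linext_ketE (V : lmodType K) (h : Pplus -> V) (lam : Pplus) :
  linext h (ket lam) = h lam.
Proof. by rewrite ket_Pplus linext_ket. Qed.

Lemma is_partE f : is_part f -> exists lam : Pplus, f = lam.
Proof. by case=> a b; exists (MkPplus a b). Qed.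

Lemma linear_ket_eq (V : lmodType K) (A B : fock K -> V) : linear A -> linear B ->
  (forall f, is_part f -> A (ket f) = B (ket f)) -> A =1 B.
Proof.
move=> lA lB h v.
have AZ (C : fock K -> V) : linear C -> forall c w, C (c *: w) = c *: C w.
  move=> lC c w; have C0 : C 0 = 0.
    by apply/(addrI (C 0)); rewrite addr0 -{1}[C 0]scale1r -lC scale1r addr0.
  by rewrite -[c *: w]addr0 lC C0 addr0.
have AD (C : fock K -> V) : linear C -> {morph C : w w' / w + w'}.
  by move=> lC w w'; rewrite -[w]scale1r lC !scale1r.
rewrite [v]monalgE; elim/big_ind: _ => [|w w' hw hw'|lam _].
- by rewrite -(scale0r 0) !AZ // !scale0r.
- by rewrite !AD // hw hw'.
have -> : << v@_lam *g lam >> = v@_lam *: << lam >> :> fock K.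
  by apply/malgP => k; rewrite mcoeffZ !mcoeffU mulr_natr.
by rewrite !AZ // -ket_Pplus; congr (_ *: _); exact/h/Pplus_is_part.
Qed.

End Kets.

(** * Ladder operators *)

Section Ladders.
Variable K : fieldType.
Implicit Types (c x : (nat -> int) -> nat -> K) (d : int).

Lemma big_ord_trim (V : nmodType) (F : nat -> V) m n : (n <= m)%N ->
  (forall i, (n <= i)%N -> F i = 0) -> \sum_(i < m) F i = \sum_(i < n) F i.
Proof.
move=> nm F0; rewrite -!(big_mkord xpredT) (big_cat_nat (n := n)) //=.
rewrite [X in _ + X]big_nat_cond [X in _ + X]big1 ?addr0 // => i.
by case/andP=> /andP[/F0].
Qed.

(** Common form of the modes of [e(z)] (for [d = 1]) and of [f(z)] (for [d = -1]):
    the delta function of the move of row [i] has amplitude [c f i] and support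
    [x f i]. *)
Definition ladder c x d (n : int) : fock K -> fock K :=
  linext (fun lam : Pplus => \sum_(i < (cutoff lam).+1)
    (c lam i * x lam i ^ n) *: ket K (bump lam i d)).

HB.instance Definition _ c x d n := GRing.Linear.copy (ladder c x d n) (linext _).

Definition allowed c d := forall f i, is_part f -> c f i != 0 -> is_part (bump f i d).

(** A row that cannot move contributes a zero ket, hence the sum may be taken up
    to any bound beyond the first empty row; composites are computed below with
    a bound common to all their factors. *)
Lemma ladderE c x d n f M N : d = 1 \/ d = -1 -> is_part f -> supp_lt M f ->
  (M < N)%N ->
  ladder c x d n (ket K f) = \sum_(i < N) (c f i * x f i ^ n) *: ket K (bump f i d).
Proof.
move=> d1 pf fM MN; have [lam fE] := is_partE pf.
rewrite fE /ladder linext_ketE -fE.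
pose F i := (c f i * x f i ^ n) *: ket K (bump f i d).
have F0 i L : supp_lt L f -> (L < i)%N -> F i = 0.
  move=> fL Li; rewrite /F ket_out ?scaler0 // => pb.
  by have := bump_part_lt d1 fL pb; rewrite leqNgt Li.
pose m := minn (cutoff f).+1 N.
have Fm i : (m <= i)%N -> F i = 0.
  rewrite /m geq_min => /orP[h|h]; first exact: (F0 _ _ (is_part_cutoff pf)).
  exact: F0 fM (leq_trans MN h).
by rewrite -/(F _) (big_ord_trim (geq_minl _ _) Fm) (big_ord_trim (geq_minr _ _) Fm).
Qed.

Lemma ladder_step c d c' x' d' n f i a M N : d = 1 \/ d = -1 -> d' = 1 \/ d' = -1 ->
  allowed c d -> is_part f -> supp_lt M f -> (M.+1 < N)%N ->
  (c f i * a) *: ladder c' x' d' n (ket K (bump f i d))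
  = \sum_(j < N) (c f i * a * (c' (bump f i d) j * x' (bump f i d) j ^ n))
      *: ket K (bump (bump f i d) j d').
Proof.
move=> d1 d1' ca pf fM MN; have [->|ci] := eqVneq (c f i) 0.
  by rewrite mul0r scale0r big1 // => j _; rewrite mul0r scale0r.
have pb := ca _ _ pf ci.
rewrite (ladderE c' x' n d1' pb (bump_part_supp d1 fM pb) MN) scaler_sumr.
by apply: eq_bigr => j _; rewrite scalerA.
Qed.

Lemma ladder2E c x d c' x' d' n n' f M N : d = 1 \/ d = -1 -> d' = 1 \/ d' = -1 ->
  allowed c d -> is_part f -> supp_lt M f -> (M.+1 < N)%N ->
  ladder c' x' d' n' (ladder c x d n (ket K f))
  = \sum_(i < N) \sum_(j < N)
      (c f i * x f i ^ n * (c' (bump f i d) j * x' (bump f i d) j ^ n'))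
      *: ket K (bump (bump f i d) j d').
Proof.
move=> d1 d1' ca pf fM MN; rewrite (ladderE _ _ _ d1 pf fM (ltnW MN)) raddf_sum.
apply: eq_bigr => i _; rewrite [LHS]linearZ /=.
by rewrite (ladder_step c' x' n' i (x f i ^ n) d1 d1' ca pf fM MN).
Qed.

Lemma ladder3E c x d n1 n2 n3 f M N : d = 1 \/ d = -1 ->
  allowed c d -> is_part f -> supp_lt M f -> (M.+2 < N)%N ->
  ladder c x d n1 (ladder c x d n2 (ladder c x d n3 (ket K f)))
  = \sum_(k < N) \sum_(j < N) \sum_(i < N)
      let f1 := bump f k d in let f2 := bump f1 j d in
      (c f k * c f1 j * c f2 i * (x f2 i ^ n1 * x f1 j ^ n2 * x f k ^ n3))
      *: ket K (bump f2 i d).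
Proof.
move=> d1 ca pf fM MN; rewrite (ladder2E x c x n3 n2 d1 d1 ca pf fM (ltnW MN)) raddf_sum.
apply: eq_bigr => k _; rewrite [LHS]raddf_sum; apply: eq_bigr => j _.
rewrite [LHS]linearZ /=.
have [ck|ck] := eqVneq (c f k) 0.
  by rewrite ck !mul0r scale0r big1 // => i _; rewrite !mul0r scale0r.
have pb := ca _ _ pf ck.
have fM1 := bump_part_supp d1 fM pb.
rewrite mulrCA (ladder_step c x n1 j _ d1 d1 ca pb fM1 MN).
apply: eq_bigr => i _ /=; congr (_ *: _); ring.
Qed.

End Ladders.

(** * Quadratic and Serre relations from an exchange relation *)

Section Smul.
Variables (K : fieldType) (V : lmodType K).
Implicit Types (p : {poly {poly K}}) (X : int -> int -> V).

Lemma eq_smul p X Y m n : (forall i j, X i j = Y i j) -> smul p X m n = smul p Y m n.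
Proof.
by move=> e; apply: eq_bigr => a _; apply: eq_bigr => b _; rewrite e.
Qed.

Lemma smul_sum p (I : Type) (s : seq I) (P : pred I) (X : I -> int -> int -> V) m n :
  smul p (fun i j => \sum_(k <- s | P k) X k i j) m n
  = \sum_(k <- s | P k) smul p (X k) m n.
Proof.
rewrite /smul [RHS]exchange_big; apply: eq_bigr => a _.
rewrite [RHS]exchange_big; apply: eq_bigr => b _.
by rewrite scaler_sumr.
Qed.

Lemma smulZ p a X m n : smul p (fun i j => a *: X i j) m n = a *: smul p X m n.
Proof.
rewrite /smul scaler_sumr; apply: eq_bigr => k _.
by rewrite scaler_sumr; apply: eq_bigr => l _; rewrite !scalerA mulrC.
Qed.

(** The coefficients of a delta function form a geometric sequence, so that
    multiplication by a polynomial is evaluation at its support. *)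
Lemma smul_inner p (w : K) (X : int -> V) m n : w != 0 ->
  smul p (fun i j => w ^ j *: X i) m n
  = w ^ n *: \sum_(a < size p) (p`_a).[w] *: X (m + a%:Z).
Proof.
move=> w0; rewrite /smul scaler_sumr; apply: eq_bigr => a _.
rewrite horner_coef scaler_suml scaler_sumr; apply: eq_bigr => b _.
by rewrite !scalerA expfzDr // mulrCA.
Qed.

Lemma smul_eval p (z w : K) (v : V) m n : z != 0 -> w != 0 ->
  smul p (fun i j => (z ^ i * w ^ j) *: v) m n
  = (z ^ m * w ^ n * p.[z%:P].[w]) *: v.
Proof.
move=> z0 w0.
rewrite (@eq_smul _ _ (fun i j => w ^ j *: (z ^ i *: v))); last first.
  by move=> i j; rewrite scalerA mulrC.
rewrite smul_inner // (horner_coef p) horner_sum mulr_sumr scaler_suml scaler_sumr.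
apply: eq_bigr => a _; rewrite !scalerA !hornerE expfzDr //; congr (_ *: _).
rewrite -exprnP /=; ring.
Qed.

End Smul.

Section Exchange.
Variable K : fieldType.
Variables (s1 s2 r : K) (c x : (nat -> int) -> nat -> K) (d : int).

Local Notation G := (cubic s1 s2).

(** What [e(z)] and [f(z)] have in common: [G] is the structure function, and
    the exchange clause is the quadratic relation for two different rows. The
    clauses on [G <> 0] concern a row [j] that can move before row [i] does: then
    the factor by which the two orders differ has no pole. The last one is
    the case of a row moving twice after row [k], where the factor at its
    second support [r * x f i] matters as well. *)
Record exchange_ladder : Prop := ExchangeLadder {
  ladder_step1 : d = 1 \/ d = -1;
  ladder_allowed : allowed c d;
  ladder_x_neq0 : forall f i, x f i != 0;
  ladder_x_other : forall f i j, i != j -> x (bump f j d) i = x f i;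
  ladder_x_self : forall f i, x (bump f i d) i = r * x f i;
  ladder_r_neq0 : r != 0;
  ladder_G_self : forall y, G (r * y) y = 0;
  ladder_G_self_rev : forall y, y != 0 -> G y (r * y) != 0;
  ladder_exchange : forall f i j, is_part f -> i != j ->
    G (x f j) (x f i) * (c f i * c (bump f i d) j)
    = - (G (x f i) (x f j) * (c f j * c (bump f j d) i));
  ladder_G_neq0 : forall f i j, is_part f -> i != j -> is_part (bump f j d) ->
    G (x f j) (x f i) != 0;
  ladder_G_neq0_twice : forall f i k, is_part f -> i != k -> is_part (bump f k d) ->
    is_part (bump (bump f k d) i d) ->
    is_part (bump (bump (bump f k d) i d) i d) ->
    G (x f k) (r * x f i) != 0
}.

Hypothesis L : exchange_ladder.

(** Weight of an order of three moves in [[e_0, [e_1, e_(-1)]]]. *)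
Definition serre_weight (z1 z2 z3 : K) : K :=
  z2 / z3 - z3 / z2 - z1 / z2 + z2 / z1.

Lemma serre_weightE z1 z2 z3 : z1 != 0 -> z2 != 0 -> z3 != 0 ->
  serre_weight z1 z2 z3 = serre_poly z1 z2 z3 / (z1 * z2 * z3).
Proof. by move=> *; rewrite /serre_weight /serre_poly; field; apply/and3P. Qed.

(** [T123] and its permutations are the amplitudes of the six orders of three
    moves. The exchange relations make them multiples of [T123], provided the
    structure functions on that side do not vanish; the sum is then [T123] times
    the vanishing antisymmetrization. *)
Lemma serre_six z1 z2 z3 T123 T213 T132 T231 T312 T321 :
  z1 != 0 -> z2 != 0 -> z3 != 0 ->
  G z2 z1 != 0 -> G z3 z1 != 0 -> G z3 z2 != 0 ->
  G z1 z2 * T123 = - (G z2 z1 * T213) ->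
  G z2 z3 * T123 = - (G z3 z2 * T132) ->
  G z1 z3 * T213 = - (G z3 z1 * T231) ->
  G z1 z3 * T132 = - (G z3 z1 * T312) ->
  G z2 z3 * T231 = - (G z3 z2 * T321) ->
  T123 * serre_weight z1 z2 z3 + T213 * serre_weight z2 z1 z3
  + T132 * serre_weight z1 z3 z2 + T231 * serre_weight z2 z3 z1
  + T312 * serre_weight z3 z1 z2 + T321 * serre_weight z3 z2 z1 = 0.
Proof.
move=> z1n z2n z3n g21 g31 g32 h1 h2 h3 h4 h5.
rewrite !serre_weightE //.
have e := serre_poly_antisym s1 s2 z1 z2 z3.
rewrite /= in e.
have P n m p : z1 * z2 * z3 = n -> m = p -> m / n = p / (z1 * z2 * z3).
  by move=> <- ->.
rewrite !mulrA (P (z2 * z1 * z3) _ _ _ erefl); last ring.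
rewrite (P (z1 * z3 * z2) _ _ _ erefl); last ring.
rewrite (P (z2 * z3 * z1) _ _ _ erefl); last ring.
rewrite (P (z3 * z1 * z2) _ _ _ erefl); last ring.
rewrite (P (z3 * z2 * z1) _ _ _ erefl); last ring.
rewrite -!mulrDl; apply/eqP; rewrite mulf_eq0; apply/orP; left.
have gn : G z2 z1 * G z3 z1 * G z3 z2 != 0 by rewrite !mulf_neq0.
rewrite -(mulrI_eq0 _ (mulfI gn)); apply/eqP.
have h21 : G z2 z1 * T213 = - (G z1 z2 * T123) by rewrite h1 opprK.
have h32 : G z3 z2 * T132 = - (G z2 z3 * T123) by rewrite h2 opprK.
have h31 : G z3 z1 * T231 = - (G z1 z3 * T213) by rewrite h3 opprK.
have h31' : G z3 z1 * T312 = - (G z1 z3 * T132) by rewrite h4 opprK.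
have h32' : G z3 z2 * T321 = - (G z2 z3 * T231) by rewrite h5 opprK.
move: e h21 h32 h31 h31' h32' {h1 h2 h3 h4 h5 gn g21 g31 g32 P}.
move: (G z2 z1) (G z3 z1) (G z3 z2) (G z1 z2) (G z1 z3) (G z2 z3).
move=> a b cc a' b' c' e h21 h32 h31 h31' h32'.
rewrite -(mulr0 T123) -e.
(* Each round of exchange relations shortens the remaining permutations. *)
set p1 := serre_poly z1 z2 z3; set p2 := serre_poly z2 z1 z3.
set p3 := serre_poly z1 z3 z2; set p4 := serre_poly z2 z3 z1.
set p5 := serre_poly z3 z1 z2; set p6 := serre_poly z3 z2 z1.
transitivity (T123 * p1 * (a * b * cc) + (a * T213) * p2 * (b * cc)
  + (cc * T132) * p3 * (a * b) + (b * T231) * (a * cc) * p4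
  + (b * T312) * p5 * (a * cc) + (cc * T321) * p6 * (a * b)); first by ring.
rewrite h21 h32 h31 h31' h32'.
transitivity (T123 * p1 * (a * b * cc) + (- (a' * T123)) * p2 * (b * cc)
  + (- (c' * T123)) * p3 * (a * b) - b' * (a * T213) * cc * p4
  - b' * (cc * T132) * p5 * a - c' * (b * T231) * p6 * a); first by ring.
rewrite h21 h32 h31.
transitivity (T123 * p1 * (a * b * cc) + (- (a' * T123)) * p2 * (b * cc)
  + (- (c' * T123)) * p3 * (a * b) - b' * (- (a' * T123)) * cc * p4
  - b' * (- (c' * T123)) * p5 * a + c' * b' * (a * T213) * p6); first by ring.
rewrite h21; ring.
Qed.


(** Both sides are sums over ordered pairs of rows; swapping the two rows in one
    of them turns the claim into the exchange relation. A repeated row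
    contributes nothing because its two supports are at a zero of [G]. *)
Lemma ladder_quadratic (p p' : {poly {poly K}}) (e : K) f m n :
  (forall z w, p.[z%:P].[w] = e * G z w) ->
  (forall z w, p'.[z%:P].[w] = e * G w z) -> is_part f ->
  smul p (fun i j => ladder c x d i (ladder c x d j (ket K f))) m n
  = - smul p' (fun i j => ladder c x d j (ladder c x d i (ket K f))) m n.
Proof.
move=> pE p'E pf; have fM := is_part_cutoff pf.
set M := cutoff f in fM; have MN : (M.+1 < M.+2)%N by [].
have [d1 ca] := (ladder_step1 L, ladder_allowed L).
have x0 := ladder_x_neq0 L.
have E2 k l := ladder2E x c x k l d1 d1 ca pf fM MN.
rewrite (eq_smul p _ _ (fun i j => E2 j i)) (eq_smul p' _ _ E2) !smul_sum.
rewrite (eq_bigr (fun i : 'I_M.+2 => \sum_(j < M.+2)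
   (c f i * c (bump f i d) j * (x (bump f i d) j ^ m * x f i ^ n
     * (e * G (x (bump f i d) j) (x f i)))) *: ket K (bump (bump f i d) j d)));
  last first.
  move=> i _; rewrite smul_sum; apply: eq_bigr => j _.
  rewrite -pE -scalerA -smul_eval ?x0 // -smulZ; apply: eq_smul => k l.
  by rewrite scalerA; congr (_ *: _); ring.
rewrite [X in - X](eq_bigr (fun i : 'I_M.+2 => \sum_(j < M.+2)
   (c f i * c (bump f i d) j * (x f i ^ m * x (bump f i d) j ^ n
     * (e * G (x (bump f i d) j) (x f i)))) *: ket K (bump (bump f i d) j d)));
  last first.
  move=> i _; rewrite smul_sum; apply: eq_bigr => j _.
  rewrite -p'E -scalerA -smul_eval ?x0 // -smulZ; apply: eq_smul => k l.
  by rewrite scalerA; congr (_ *: _); ring.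
rewrite [X in - X]exchange_big -sumrN; apply: eq_bigr => i _.
rewrite -sumrN; apply: eq_bigr => j _ /=; rewrite -scaleNr.
have [->|/negPf ij] := eqVneq i j.
  by rewrite (ladder_x_self L) (ladder_G_self L) !mulr0 oppr0.
rewrite -val_eqE /= in ij; rewrite bumpC; congr (_ *: _).
rewrite !(ladder_x_other L) ?ij // 1?eq_sym ?ij //.
have h := ladder_exchange L pf (negbT ij).
transitivity (G (x f j) (x f i) * (c f i * c (bump f i d) j)
              * (e * (x f j ^ m * x f i ^ n))); first by ring.
by rewrite h; ring.
Qed.

Definition amp3 f i j k : K :=
  let f1 := bump f k d in let f2 := bump f1 j d in c f k * c f1 j * c f2 i.

Definition serre_term f i j k : K :=
  let f1 := bump f k d in let f2 := bump f1 j d in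
  amp3 f i j k * serre_weight (x f2 i) (x f1 j) (x f k).

Definition serre_sym f i j k : K :=
  serre_term f i j k + serre_term f j i k + serre_term f i k j
  + serre_term f j k i + serre_term f k i j + serre_term f k j i.

Lemma amp3_swap_last f i j k : is_part f -> i != j ->
  let f1 := bump f k d in
  G (x f1 i) (x f1 j) * amp3 f i j k = - (G (x f1 j) (x f1 i) * amp3 f j i k).
Proof.
move=> pf ij f1; rewrite /amp3 -/f1.
have [->|ck] := eqVneq (c f k) 0; first by rewrite !mul0r !mulr0 oppr0.
have pf1 : is_part f1 := ladder_allowed L pf ck.
have ji : j != i by rewrite eq_sym.
have h := ladder_exchange L pf1 ji.
transitivity (c f k * (G (x f1 i) (x f1 j) * (c f1 j * c (bump f1 j d) i))).
  by ring.
by rewrite h; ring.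
Qed.

Lemma amp3_swap_first f i j k : is_part f -> j != k ->
  G (x f j) (x f k) * amp3 f i j k = - (G (x f k) (x f j) * amp3 f i k j).
Proof.
move=> pf jk; rewrite /amp3 (bumpC f j).
have kj : k != j by rewrite eq_sym.
have h := ladder_exchange L pf kj.
by rewrite [LHS]mulrA h; ring.
Qed.

Lemma amp3_parts f i j k : is_part f -> amp3 f i j k != 0 ->
  [/\ is_part (bump f k d), is_part (bump (bump f k d) j d)
    & is_part (bump (bump (bump f k d) j d) i d)].
Proof.
move=> pf; rewrite /amp3 !mulf_eq0 !negb_or => /andP[/andP[ck cj] ci].
have p1 := ladder_allowed L pf ck; have p2 := ladder_allowed L p1 cj.
by split=> //; exact: (ladder_allowed L p2 ci).
Qed.

(** An order of nonzero amplitude serves as the reference order of [serre_six]: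
    since each of its moves is possible, the structure functions to be divided by
    do not vanish. *)
Lemma serre_distinct_valid f i j k : is_part f -> i != j -> i != k -> j != k ->
  amp3 f i j k != 0 -> serre_sym f i j k = 0.
Proof.
move=> pf ij ik jk /(amp3_parts pf)[p1 p2 _].
have x0 := ladder_x_neq0 L; have xo := ladder_x_other L.
have [ji ki kj] : [/\ j != i, k != i & k != j] by rewrite (eq_sym j) !(eq_sym k).
have Gji := ladder_G_neq0 L p1 ij p2; rewrite !xo // in Gji.
have Gki := ladder_G_neq0 L pf ik p1; have Gkj := ladder_G_neq0 L pf jk p1.
have sl a b e (ab : a != b) := amp3_swap_last e pf ab.
have sf a b e (ab : a != b) := amp3_swap_first e pf ab.
rewrite /serre_sym /serre_term !xo //.
apply: serre_six => //; try exact: (sf _ _ _ _).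
- by have := sl i j k ij; rewrite /= !xo.
- by have := sl i k j ik; rewrite /= !xo.
- by have := sl j k i jk; rewrite /= !xo.
Qed.

Lemma serre_sym_perm f i j k :
  (serre_sym f j i k = serre_sym f i j k) * (serre_sym f i k j = serre_sym f i j k).
Proof. by split; rewrite /serre_sym; ring. Qed.

Lemma serre_term_amp0 f i j k : amp3 f i j k = 0 -> serre_term f i j k = 0.
Proof. by rewrite /serre_term => ->; rewrite mul0r. Qed.

Lemma serre_distinct f i j k : is_part f -> i != j -> i != k -> j != k ->
  serre_sym f i j k = 0.
Proof.
move=> pf ij ik jk.
have [ji ki kj] : [/\ j != i, k != i & k != j] by rewrite (eq_sym j) !(eq_sym k).
pose sp := serre_sym_perm f.
have [z1|n1] := eqVneq (amp3 f i j k) 0; last exact: serre_distinct_valid.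
have [z2|n2] := eqVneq (amp3 f j i k) 0; last first.
  by rewrite -(sp i j k).1; exact: serre_distinct_valid.
have [z3|n3] := eqVneq (amp3 f i k j) 0; last first.
  by rewrite -(sp i j k).2; exact: serre_distinct_valid.
have [z4|n4] := eqVneq (amp3 f j k i) 0; last first.
  by rewrite -(sp i j k).1 -(sp j i k).2; exact: serre_distinct_valid.
have [z5|n5] := eqVneq (amp3 f k i j) 0; last first.
  by rewrite -(sp i j k).2 -(sp i k j).1; exact: serre_distinct_valid.
have [z6|n6] := eqVneq (amp3 f k j i) 0; last first.
  by rewrite -(sp i j k).1 -(sp j i k).2 -(sp j k i).1; exact: serre_distinct_valid.
by rewrite /serre_sym !serre_term_amp0 // !addr0.
Qed.

(** When one row moves twice, the orders which would reverse its two moves have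
    amplitude zero, which is consistent with the exchange relations because their
    factor is at a zero of [G]. *)
Lemma serre_repeated f i k : is_part f -> i != k ->
  serre_term f i i k + serre_term f i k i + serre_term f k i i = 0.
Proof.
move=> pf ik; have ki : k != i by rewrite eq_sym.
have x0 := ladder_x_neq0 L; have xo := ladder_x_other L.
have xs := ladder_x_self L; have r0 := ladder_r_neq0 L.
have G0 := ladder_G_self L (x f i); have G0' := ladder_G_self_rev L (x0 f i).
set w := x f i in G0 G0'; set y := x f k.
have w0 : w != 0 := x0 _ _; have rw0 : r * w != 0 by rewrite mulf_neq0.
have y0 : y != 0 := x0 _ _.
have h1 := amp3_swap_first i pf ik; rewrite -/w -/y in h1.
have h2 := amp3_swap_last i pf ik; rewrite /= xs xo // -/w -/y in h2.
rewrite /serre_term !(xs, xo) // -/w -/y.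
have [n1|z1] := boolP (amp3 f i i k != 0).
  have [p1 p2 p3] := amp3_parts pf n1.
  have Gyw : G y w != 0 := ladder_G_neq0 L pf ik p1.
  have Gyrw : G y (r * w) != 0 := ladder_G_neq0_twice L pf ik p1 p2 p3.
  have := @serre_six (r * w) w y (amp3 f i i k) 0 (amp3 f i k i) 0 (amp3 f k i i) 0
    rw0 w0 y0 G0' Gyrw Gyw.
  rewrite !mul0r !addr0; apply; rewrite ?mulr0 ?oppr0 //.
  by rewrite G0 mul0r.
have [n2|z2] := boolP (amp3 f i k i != 0).
  have [p1 p2 p3] := amp3_parts pf n2.
  have Gwy : G w y != 0 := ladder_G_neq0 L pf ki p1.
  have Gyrw : G y (r * w) != 0.
    by have := ladder_G_neq0 L p1 ik p2; rewrite xs xo.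
  have := @serre_six (r * w) y w (amp3 f i k i) (amp3 f k i i) (amp3 f i i k) 0 0 0
    rw0 y0 w0 Gyrw G0' Gwy h2 _.
  rewrite !mul0r !addr0 => <-; rewrite ?G0 ?mulr0 ?mul0r ?oppr0 //; last first.
    by rewrite -[LHS]opprK -h1.
  by ring.
have [n3|z3] := boolP (amp3 f k i i != 0).
  have [p1 p2 p3] := amp3_parts pf n3.
  have Gwy : G w y != 0 := ladder_G_neq0 L pf ki p1.
  have Grwy : G (r * w) y != 0.
    by have := ladder_G_neq0 L p1 ki p2; rewrite xs xo.
  have := @serre_six y (r * w) w (amp3 f k i i) (amp3 f i k i) 0 (amp3 f i i k) 0 0
    y0 rw0 w0 Grwy Gwy G0' _ _ _.
  rewrite !mul0r !addr0 => <-; rewrite ?G0 ?mulr0 ?mul0r ?oppr0 //.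
  - by ring.
  - by rewrite h2 opprK.
  - by rewrite h1 opprK.
move: z1 z2 z3; rewrite !negbK => /eqP -> /eqP -> /eqP ->.
by rewrite !mul0r !addr0.
Qed.

Lemma serre_diag f i : serre_term f i i i = 0.
Proof.
have w0 := ladder_x_neq0 L f i; have r0 := ladder_r_neq0 L.
rewrite /serre_term !(ladder_x_self L) /serre_weight; set w := x f i in w0 *.
by field; rewrite w0 r0.
Qed.

Lemma serre_sym0 f i j k : is_part f -> serre_sym f i j k = 0.
Proof.
move=> pf; have sp := serre_sym_perm f.
suff rep a b : serre_sym f a a b = 0.
  have [->|ij] := eqVneq i j; first exact: rep.
  have [->|ik] := eqVneq i k; first by rewrite -(sp _ _ _).2 rep.
  have [->|jk] := eqVneq j k; last exact: serre_distinct.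
  by rewrite -(sp _ _ _).1 -(sp _ _ _).2 rep.
have [->|ab] := eqVneq a b; first by rewrite /serre_sym !serre_diag !addr0.
transitivity ((serre_term f a a b + serre_term f a b a + serre_term f b a a) *+ 2).
  by rewrite /serre_sym; ring.
by rewrite serre_repeated // mul0rn.
Qed.

(** Every order of three moves occurs six times in the sum of all permuted terms,
    whence the division by 6. *)
Lemma sum_sym3_eq0 (V : lmodType K) N (F : 'I_N -> 'I_N -> 'I_N -> V) :
  6%:R != 0 :> K ->
  (forall i j k, F i j k + F j i k + F i k j + F j k i + F k i j + F k j i = 0) ->
  \sum_k \sum_j \sum_i F i j k = 0.
Proof.
move=> n6 F0; set S := LHS.
have e1 : S = \sum_k \sum_j \sum_i F j i k.
  by apply: eq_bigr => k _; rewrite exchange_big.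
have e2 : S = \sum_k \sum_j \sum_i F i k j by rewrite /S exchange_big.
have e3 : S = \sum_k \sum_j \sum_i F j k i.
  by rewrite e2; apply: eq_bigr => k _; rewrite exchange_big.
have e4 : S = \sum_k \sum_j \sum_i F k i j by rewrite e1 exchange_big.
have e5 : S = \sum_k \sum_j \sum_i F k j i.
  by rewrite e4; apply: eq_bigr => k _; rewrite exchange_big.
have : S + S + S + S + S + S = 0.
  rewrite {6}e5 {5}e4 {4}e3 {3}e2 {2}e1 -!big_split big1 // => k _.
  rewrite -!big_split big1 // => j _; rewrite -!big_split big1 //= => i _.
move=> h; apply/eqP; have : 6%:R *: S == 0.
  by rewrite scaler_nat -h !mulrS mulr0n addr0 !addrA.
by rewrite scaler_eq0 (negPf n6).
Qed.

(** The coefficient of a given target is a sum over the orders in which its three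
    new boxes are moved; it vanishes after symmetrization. *)
Lemma ladder_serre f (E := ladder c x d) : 6%:R != 0 :> K -> is_part f ->
  E 0 (E 1 (E (-1) (ket K f))) - E 0 (E (-1) (E 1 (ket K f)))
  - E 1 (E (-1) (E 0 (ket K f))) + E (-1) (E 1 (E 0 (ket K f))) = 0.
Proof.
move=> n6 pf; have fM := is_part_cutoff pf.
set M := cutoff f in fM; have MN : (M.+2 < M.+3)%N by [].
have [d1 ca] := (ladder_step1 L, ladder_allowed L).
rewrite /E !(ladder3E x _ _ _ d1 ca pf fM MN) -!sumrB -big_split /=.
transitivity (\sum_(k < M.+3) \sum_(j < M.+3) \sum_(i < M.+3)
    serre_term f i j k *: ket K (bump (bump (bump f k d) j d) i d)).
  apply: eq_bigr => k _; rewrite -!sumrB -big_split /=.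
  apply: eq_bigr => j _; rewrite -!sumrB -big_split /=.
  apply: eq_bigr => i _; rewrite -!scalerBl -scalerDl; congr (_ *: _).
  rewrite /serre_term /amp3 /serre_weight !expr0z !expr1z !exprN1; ring.
apply: sum_sym3_eq0 => // i j k.
pose B a b e := ket K (bump (bump (bump f a d) b d) e d).
have B12 a b e : B a b e = B b a e by rewrite /B (bumpC f).
have B23 a b e : B a b e = B a e b by rewrite /B bumpC.
have e2 : B i k j = B i j k by rewrite B23.
have e3 : B j i k = B i j k by rewrite B12.
have e4 : B k i j = B i j k by rewrite B12 B23.
have e5 : B j k i = B i j k by rewrite B23 B12.
have e6 : B k j i = B i j k by rewrite B12 B23 B12.
rewrite -!/(B _ _ _) e2 e3 e4 e5 e6.
by rewrite -!scalerDl -/(serre_sym f i j k) serre_sym0 // scale0r.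
Qed.

End Exchange.

(** * Two-sided sequences and partial fractions *)

Section ShiftAction.
Variable K : fieldType.
Implicit Types (p q : {poly K}) (s : int -> K).

(** Multiplication by the polynomial [p] in [z] of the formal series whose
    coefficient of [z^-m] is [s m]. *)
Definition sact p s : int -> K := fun m => \sum_(a < size p) p`_a * s (m + a%:Z).

Lemma sactE N p s m : (size p <= N)%N ->
  sact p s m = \sum_(a < N) p`_a * s (m + a%:Z).
Proof.
move=> pN; rewrite /sact.
rewrite (@big_ord_trim K (fun a : nat => p`_a * s (m + a%:Z)) N (size p)) // => i hi.
by rewrite nth_default ?mul0r.
Qed.

Lemma sactD p q s : sact (p + q) s = fun m => sact p s m + sact q s m.
Proof.
apply/funext => m; set N := maxn (size p) (size q).
rewrite (@sactE N) ?size_polyD // (@sactE N p) ?leq_maxl //.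
rewrite (@sactE N q) ?leq_maxr // -big_split /=.
by apply: eq_bigr => a _; rewrite coefD mulrDl.
Qed.

Lemma sactC (c : K) s : sact c%:P s = fun m => c * s m.
Proof.
apply/funext => m; rewrite (@sactE 1) ?size_polyC_leq1 //.
by rewrite big_ord1 coefC addr0.
Qed.

Lemma sactZ (c : K) p s : sact (c *: p) s = fun m => c * sact p s m.
Proof.
apply/funext => m; rewrite (@sactE (size p)) ?size_scale_leq // /sact mulr_sumr.
by apply: eq_bigr => a _; rewrite coefZ mulrA.
Qed.

Lemma sactMX p s : sact (p * 'X) s = fun m => sact p s (m + 1).
Proof.
apply/funext => m; rewrite (@sactE (size p).+1); last first.
  by rewrite (leq_trans (size_polyMleq _ _)) // size_polyX addn2.
rewrite big_ord_recl coefMX mul0r add0r; apply: eq_bigr => a _.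
by rewrite coefMX /= /bump -addrA -PoszD.
Qed.

Lemma sactM p q s : sact (p * q) s = sact p (sact q s).
Proof.
elim/poly_ind: p => [|p c IH].
  by rewrite mul0r; apply/funext => m; rewrite /sact size_poly0 !big_ord0.
rewrite mulrDl !sactD -mulrA ['X * q]mulrC mulrA.
rewrite mul_polyC sactZ sactC !sactMX.
by apply/funext => m; congr (_ + _); rewrite IH.
Qed.

Lemma sactCA p q s : sact p (sact q s) = sact q (sact p s).
Proof. by rewrite -!sactM mulrC. Qed.

Lemma sactDr p s t : sact p (fun m => s m + t m) = fun m => sact p s m + sact p t m.
Proof.
apply/funext => m; rewrite /sact -big_split /=.
by apply: eq_bigr => a _; rewrite mulrDr.
Qed.

Lemma sactZr p (c : K) s : sact p (fun m => c * s m) = fun m => c * sact p s m.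
Proof.
by apply/funext => m; rewrite /sact mulr_sumr; apply: eq_bigr => a _; rewrite mulrCA.
Qed.

Lemma sact_XsubC (a : K) s : sact ('X - a%:P) s = fun m => s (m + 1) - a * s m.
Proof.
rewrite -polyCN sactD sactC -['X]mul1r -polyC1 sactMX sactC.
by apply/funext => m; rewrite mul1r mulNr.
Qed.

(** Series in [z^-1] ([e = true]) or in [z] ([e = false]), up to finitely many
    further terms. *)
Definition half_series (e : bool) s :=
  exists m0 : int, forall m, (if e then m < m0 else m0 < m) -> s m = 0.

Lemma half_sact e p s : half_series e s -> half_series e (sact p s).
Proof.
case=> m0 h; exists (if e then m0 - (size p)%:Z else m0) => m hm.
rewrite /sact big1 // => a _; rewrite h ?mulr0 //.
by have := ltn_ord a; case: e hm {h}; lia.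
Qed.

Lemma half_sub e s t : half_series e s -> half_series e t ->
  half_series e (fun m => s m - t m).
Proof.
case=> m1 h1 [m2 h2]; exists (if e then Num.min m1 m2 else Num.max m1 m2) => m hm.
rewrite h1 ?h2 ?subrr //; case: e hm {h1 h2}; rewrite ?lt_min ?gt_max; lia.
Qed.

(** The kernel of [z - a] consists of geometric sequences, which are nowhere zero
    or identically zero. *)
Lemma sact_XsubC_inj e (a : K) s : a != 0 -> half_series e s ->
  (forall m, sact ('X - a%:P) s m = 0) -> forall m, s m = 0.
Proof.
move=> a0 [m0 h]; rewrite sact_XsubC => eq m.
have step k : s (k + 1) = a * s k by apply/eqP; rewrite -subr_eq0 eq.
case: e h => h.
  have P n : s (m0 - 1 + n%:Z) = 0.
    elim: n => [|n IH]; first by apply: h; lia.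
    by rewrite -addn1 PoszD addrA step IH mulr0.
  have [?|?] := ltP m m0; first exact: h.
  by rewrite -(P (absz (m - m0 + 1)%R)); congr (s _); lia.
have P n : s (m0 + 1 - n%:Z) = 0.
  elim: n => [|n IH]; first by apply: h; lia.
  apply: (mulfI a0); rewrite mulr0 -step -[RHS]IH; congr (s _); lia.
have [?|?] := ltP m0 m; first exact: h.
by rewrite -(P (absz (m0 + 1 - m)%R)); congr (s _); lia.
Qed.

Lemma sact_prod_inj e (I : Type) (r : seq I) (a : I -> K) s :
  (forall i, a i != 0) -> half_series e s ->
  (forall m, sact (\prod_(i <- r) ('X - (a i)%:P)) s m = 0) -> forall m, s m = 0.
Proof.
move=> a0; elim: r s => [|i r IH] s hs.
  by rewrite big_nil -polyC1 sactC => h m; rewrite -[s m]mul1r h.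
rewrite big_cons sactM => h; apply: IH => //.
exact: (@sact_XsubC_inj e (a i) _ (a0 i) (half_sact _ hs) h).
Qed.

Lemma sact_at0 p s : (forall n, 0 < n -> s n = 0) -> sact p s 0 = p`_0 * s 0.
Proof.
move=> s0; rewrite (@sactE (size p).+1) // big_ord_recl big1 ?addr0 // => i _.
by rewrite s0 ?mulr0.
Qed.

Definition delta0 : int -> K := fun n => (n == 0)%:R.

(** Two series expanding the rational functions [N1 / D1] and [N2 / D2] on the
    same side are compared by cross-multiplication. *)
Lemma sact_cross e (I1 I2 : finType) (a1 : I1 -> K) (a2 : I2 -> K) G H N1 N2 s1 s2
    (D1 := \prod_i ('X - (a1 i)%:P)) (D2 := \prod_i ('X - (a2 i)%:P)) :
  (forall i, a1 i != 0) -> (forall i, a2 i != 0) ->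
  half_series e s1 -> half_series e s2 ->
  sact D1 s1 = sact N1 delta0 -> sact D2 s2 = sact N2 delta0 ->
  G * D2 * N1 = H * D1 * N2 -> sact G s1 = sact H s2.
Proof.
move=> a10 a20 h1 h2 e1 e2 ghE.
apply/funext => m; apply/eqP; rewrite -subr_eq0; apply/eqP; move: m.
apply: (sact_prod_inj (e := e) (r := index_enum I1) a10).
  by apply: half_sub; exact: half_sact.
apply: (sact_prod_inj (e := e) (r := index_enum I2) a20).
  by apply/half_sact/half_sub; exact: half_sact.
rewrite -/D1 -/D2 => m.
have sB p s t : sact p (fun m => s m - t m) = fun m => sact p s m - sact p t m.
  rewrite (_ : (fun m => s m - t m) = fun m => s m + -1 * t m); last first.
    by apply/funext => k; rewrite mulN1r.
  by rewrite sactDr sactZr; apply/funext => k; rewrite mulN1r.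
rewrite !sB; apply/eqP; rewrite subr_eq0; apply/eqP.
rewrite (sactCA D1 G) e1 (sactCA D2 G) (sactCA D1 H) (sactCA D2 H) (sactCA D2 D1) e2.
by rewrite -!sactM ghE.
Qed.

End ShiftAction.

Section PartialFractions.
Variables (K : fieldType) (I : finType) (a b : I -> K).
Hypotheses (a_inj : injective a) (a_neq0 : forall i, a i != 0).

Definition linfac (c : I -> K) : {poly K} := \prod_i ('X - (c i)%:P).
Definition linfac_but (i : I) : {poly K} := \prod_(j | j != i) ('X - (a j)%:P).
Definition residue (i : I) : K :=
  (\prod_j (a i - b j)) / \prod_(j | j != i) (a i - a j).

Lemma linfac_horner c x : (linfac c).[x] = \prod_j (x - c j).
Proof. by rewrite horner_prod; apply: eq_bigr => j _; rewrite !hornerE. Qed.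

Lemma linfac_but_horner i x : (linfac_but i).[x] = \prod_(j | j != i) (x - a j).
Proof. by rewrite horner_prod; apply: eq_bigr => j _; rewrite !hornerE. Qed.

Lemma size_linfac c : size (linfac c) = #|I|.+1.
Proof. by rewrite size_prod_XsubC cardT enumT [index_enum I]unlock. Qed.

Lemma linfac_monic c : linfac c \is monic.
Proof. exact: monic_prod_XsubC. Qed.

Lemma linfac_butE i : linfac a = ('X - (a i)%:P) * linfac_but i.
Proof. by rewrite /linfac (bigD1 i). Qed.

(** Lagrange interpolation of the difference of two monic polynomials of the same
    degree at the roots of the second one. *)
Lemma lagrange : linfac b = linfac a + \sum_i residue i *: linfac_but i.
Proof.
apply/eqP; rewrite -subr_eq0 opprD addrA; set p := _ - _.
have sp : (size p <= #|I|)%N.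
  apply/leq_sizeP => j hj; rewrite /p !coefB coef_sum big1 ?subr0; last first.
    move=> i _; rewrite coefZ nth_default ?mulr0 //.
    have := size_linfac a; rewrite (linfac_butE i) size_monicM ?monicXsubC //.
      by rewrite size_XsubC add2n /= => -[->].
    by rewrite /linfac_but; apply/prodf_neq0 => k _; rewrite polyXsubC_eq0.
  move: hj; rewrite leq_eqVlt => /orP[/eqP <-|hj]; last first.
    by rewrite !nth_default ?size_linfac // subrr.
  have lc c : (linfac c)`_#|I| = 1.
    have := linfac_monic c; rewrite monicE lead_coefE size_linfac /= => /eqP ->.
    by [].
  by rewrite !lc subrr.
apply: contraT => p0.
have : (size [seq a i | i <- enum I] < size p)%N.
  apply: max_poly_roots => //; last by rewrite map_inj_uniq ?enum_uniq.
  apply/allP => _ /mapP[i _ ->]; rewrite /root /p !hornerE horner_sum.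
  have -> : (linfac a).[a i] = 0 by rewrite linfac_horner (bigD1 i) //= subrr mul0r.
  rewrite (bigD1 i) //= big1 => [|j ji]; last first.
    by rewrite hornerZ linfac_but_horner (bigD1 i) 1?eq_sym //= subrr mul0r mulr0.
  rewrite addr0 hornerZ linfac_but_horner /residue divfK; last first.
    by apply/prodf_neq0 => j ji; rewrite subr_eq0 (inj_eq a_inj) eq_sym.
  by rewrite subr0 linfac_horner subrr.
by rewrite size_map -cardE ltnNge sp.
Qed.

(** The expansions of [1 / (z - a)], in [z^-1] for [e = true] and in [z] for
    [e = false]; they differ by a bilateral geometric series. *)
Definition simple_pole (e : bool) (c : K) (n : int) : K :=
  if e then (if 1 <= n then c ^ (n - 1) else 0)
  else (if n <= 0 then - c ^ (n - 1) else 0).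

Lemma sact_simple_pole e (c : K) : c != 0 ->
  sact ('X - c%:P) (simple_pole e c) = @delta0 K.
Proof.
move=> c0; rewrite sact_XsubC; apply/funext => m; rewrite /delta0 /simple_pole.
have cm : c * c ^ (m - 1) = c ^ m by rewrite -{1}[c]expr1z -expfzDr // addrC subrK.
rewrite addrK; case: e.
  have [->|m0] := eqVneq m 0; first by rewrite expr0z mulr0 subr0.
  have -> : (1 <= m + 1) = (1 <= m) by lia.
  by case: ifP => _; rewrite ?mulr0 ?subr0 // cm subrr.
have [->|m0] := eqVneq m 0.
  by rewrite exprN1 mulrN divff // opprK add0r.
have -> : (m + 1 <= 0) = (m <= 0) by lia.
by case: ifP => _; rewrite ?mulr0 ?subr0 // mulrN cm opprK addNr.
Qed.

Lemma simple_poleB (c : K) n :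
  simple_pole true c n - simple_pole false c n = c ^ (n - 1).
Proof.
rewrite /simple_pole; have -> : (n <= 0) = ~~ (1 <= n) by lia.
by case: ifP => _; rewrite ?subr0 // opprK add0r.
Qed.

(** Expansion of the product of the [(z - b i) / (z - a i)] by partial fractions. *)
Definition ratio_series (e : bool) (n : int) : K :=
  delta0 K n + \sum_i residue i * simple_pole e (a i) n.

Lemma ratio_series_out (e : bool) n : (if e then n < 0 else 0 < n) -> ratio_series e n = 0.
Proof.
rewrite /ratio_series /delta0 /simple_pole => h; rewrite big1 ?addr0 => [|i _].
  by case: eqP h => // ->; rewrite ltxx; case: e.
by case: e h => h; case: ifP; rewrite ?mulr0 //; lia.
Qed.

Lemma half_ratio_series e : half_series e (ratio_series e).
Proof. by exists 0 => m; exact: ratio_series_out. Qed.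

(** The two expansions differ by the delta functions at the poles. *)
Lemma ratio_seriesB n :
  ratio_series true n - ratio_series false n = \sum_i residue i * a i ^ (n - 1).
Proof.
rewrite /ratio_series opprD addrACA subrr add0r -sumrB.
by apply: eq_bigr => i _; rewrite -mulrBr simple_poleB.
Qed.

Lemma ratio_series_pos0 : ratio_series true 0 = 1.
Proof.
by rewrite /ratio_series /delta0 eqxx big1 ?addr0 // => i _; rewrite mulr0.
Qed.

Lemma sact_sumr (J : Type) (r : seq J) (p : {poly K}) (c : J -> K)
    (s : J -> int -> K) :
  sact p (fun n => \sum_(j <- r) c j * s j n)
  = fun n => \sum_(j <- r) c j * sact p (s j) n.
Proof.
elim: r => [|j r IH].
  apply/funext => n; rewrite big_nil /sact big1 // => k _.
  by rewrite big_nil mulr0.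
rewrite (_ : (fun n => _) = fun n => c j * s j n + \sum_(j <- r) c j * s j n).
  by rewrite sactDr sactZr IH; apply/funext => n; rewrite big_cons.
by apply/funext => n; rewrite big_cons.
Qed.

Lemma sact_ratio_series e :
  sact (linfac a) (ratio_series e) = sact (linfac b) (@delta0 K).
Proof.
rewrite /ratio_series sactDr sact_sumr lagrange sactD; apply/funext => n.
congr (_ + _).
have sact_sum (J : Type) (r : seq J) (c : J -> K) (p : J -> {poly K}) s :
    sact (\sum_(j <- r) c j *: p j) s = fun n => \sum_(j <- r) c j * sact (p j) s n.
  elim: r => [|j r IH].
    by apply/funext => k; rewrite big_nil /sact size_poly0 big_ord0 big_nil.
  rewrite big_cons sactD sactZ IH; apply/funext => k.
  by rewrite big_cons.
rewrite sact_sum; apply: eq_bigr => i _; congr (_ * _).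
by rewrite (linfac_butE i) mulrC sactM sact_simple_pole.
Qed.

Lemma ratio_series_neg0 : (forall i, b i != 0) ->
  ratio_series false 0 = \prod_i (b i / a i).
Proof.
move=> b0; have := congr1 (fun s => s 0) (sact_ratio_series false).
have prod0 c : (linfac c)`_0 = \prod_i (- c i).
  by rewrite -horner_coef0 linfac_horner; apply: eq_bigr => i _; rewrite sub0r.
rewrite !sact_at0 => [|n n0|n n0]; last 2 first.
- by rewrite /delta0; case: eqP n0 => // ->.
- exact: ratio_series_out.
rewrite !prod0 /delta0 eqxx mulr1 => h.
have P0 : \prod_i (- a i) != 0 by apply/prodf_neq0 => i _; rewrite oppr_eq0.
apply: (mulfI P0); rewrite h -big_split; apply: eq_bigr => i _ /=.
by field; exact: a_neq0.
Qed.

End PartialFractions.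

(** * Box weights and interaction factors *)

Section Amplitudes.
Variables (K : fieldType) (q1 q2 q3 u : K).
Hypotheses (q1_neq0 : q1 != 0) (q3_neq0 : q3 != 0) (u_neq0 : u != 0).
Hypothesis q123 : q1 * q2 * q3 = 1.
Hypothesis generic : forall n m : int, q1 ^ n * q3 ^ m = 1 -> n = 0 /\ m = 0.

Local Notation cf := (cfactor q1 q3).
Local Notation g := (gfun q1 q2 q3).

Lemma q2E : q2 = (q1 * q3)^-1.
Proof.
apply: (mulfI q1_neq0); apply: (mulIf q3_neq0); rewrite q123.
by field; rewrite q1_neq0 q3_neq0.
Qed.

Lemma generic_neq1 (n m : int) : (n != 0) || (m != 0) -> 1 - q1 ^ n * q3 ^ m != 0.
Proof.
move=> nm; rewrite subr_eq0 eq_sym; apply: contraL nm => /eqP/generic[-> ->].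
by rewrite !eqxx.
Qed.

Lemma q1_sub1_neq0 : 1 - q1 != 0.
Proof. by have := @generic_neq1 1 0 isT; rewrite expr1z expr0z mulr1. Qed.

Lemma q3_sub1_neq0 : 1 - q3 != 0.
Proof. by have := @generic_neq1 0 1 isT; rewrite expr1z expr0z mul1r. Qed.

Lemma q13_sub1_neq0 : 1 - q1 * q3 != 0.
Proof. by have := @generic_neq1 1 1 isT; rewrite !expr1z. Qed.

Lemma q2_sub1_neq0 : 1 - q2 != 0.
Proof.
have e : 1 - q2 = - (1 - q1 * q3) * q2.
  by rewrite q2E; field; rewrite q1_neq0 q3_neq0.
have n2 : q2 != 0 by rewrite q2E invr_eq0 mulf_neq0.
by rewrite e mulf_neq0 // oppr_eq0 q13_sub1_neq0.
Qed.

(** Support of the delta function attached to the end of row [i] when it has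
    length [a]. *)
Definition supp (a : int) (i : nat) : K := q1 ^ a * q3 ^+ i * u.

Lemma supp_neq0 a i : supp a i != 0.
Proof. by rewrite /supp !mulf_neq0 ?expfz_neq0 ?expf_neq0. Qed.

#[local] Hint Resolve supp_neq0 : core.

Lemma suppD a b i : supp (a + b) i = q1 ^ b * supp a i.
Proof. by rewrite /supp expfzDr //; ring. Qed.

Lemma supp_ratio a b i j :
  supp a i = q1 ^ (a - b) * q3 ^ (i%:Z - j%:Z) * supp b j.
Proof.
rewrite /supp !expfzDr // -!invr_expz -!exprnP.
by field; rewrite expfz_neq0 // expf_neq0.
Qed.

Lemma supp_inj a b i j (e k : int) : supp a i = q1 ^ e * q3 ^ k * supp b j ->
  a = b + e /\ i%:Z = j%:Z + k.
Proof.
rewrite (supp_ratio a b i j) => /(mulIf (supp_neq0 _ _)) h.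
have [|h1 h2] := @generic (a - b - e) (i%:Z - j%:Z - k); last by split; lia.
rewrite expfzDr // [q3 ^ _]expfzDr // -!invr_expz mulrACA h.
by field; rewrite !expfz_neq0.
Qed.

(** By genericity the structure function of two box weights vanishes only if the
    first box is the right, lower or upper-left neighbour of the second. *)
Lemma gfun_supp_neq0 a b i j :
  ~ (a = b + 1 /\ i = j) -> ~ (a = b /\ i = j.+1) -> ~ (a = b - 1 /\ i.+1 = j) ->
  g (supp a i) (supp b j) != 0.
Proof.
move=> n1 n3 n2; rewrite /gfun !mulf_neq0 // subr_eq0; apply/eqP => h.
- have [|h1 h2] := @supp_inj a b i j 1 0; first by rewrite expr1z expr0z mulr1.
  by apply: n1; split; lia.
- have [|h1 h2] := @supp_inj a b i j (-1) (-1).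
    by rewrite !exprN1 -invfM mulrC -q2E mulrC.
  by apply: n2; split; lia.
- have [|h1 h2] := @supp_inj a b i j 0 1; first by rewrite expr1z expr0z mul1r.
  by apply: n3; split; lia.
Qed.

Lemma cfactorE l d (X := q1 ^ l * q3 ^ d) :
  cf l d = (1 - X / q3) * (1 - q1 * q3 * X) / ((1 - X) * (1 - q1 * X)).
Proof.
rewrite /cfactor /X !expfzDr // !expr1z !exprN1.
by congr (_ / _); ring.
Qed.

Lemma cfactor01 : cf 0 1 = 0.
Proof. by rewrite /cfactor subrr !expr0z mulr1 subrr !mul0r. Qed.

(** Two consecutive interaction factors share one linear factor; the six others
    are those of the two values of [g], because [q2 = (q1 q3)^-1]. *)
Lemma cfactor_step (a b : int) i j : (i < j)%N ->
  g (supp b j) (supp a i) * cf (b - a - 1) (j%:Z - i%:Z)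
  = - (g (supp a i) (supp b j) * cf (b - a) (j%:Z - i%:Z)).
Proof.
move=> ij; rewrite (supp_ratio b a j i) !cfactorE.
set y := supp a i; rewrite [q1 ^ (b - a - 1)]expfzDr // exprN1.
set X := q1 ^ (b - a) * q3 ^ _; have d0 : j%:Z - i%:Z != 0 by lia.
have n0 := @generic_neq1 (b - a) (j%:Z - i%:Z); rewrite d0 orbT in n0.
have n1 := @generic_neq1 (b - a + 1) (j%:Z - i%:Z); rewrite d0 orbT in n1.
have n2 := @generic_neq1 (b - a - 1) (j%:Z - i%:Z); rewrite d0 orbT in n2.
have {n0} := n0 isT; have {n1} := n1 isT; have {n2} := n2 isT.
rewrite ![q1 ^ (b - a + _)]expfzDr // expr1z exprN1.
rewrite [_ / q1 * _]mulrAC [_ * q1 * _]mulrAC -/X => n2 n1 n0.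
have n3 : q1 - X != 0.
  by rewrite -[q1]mul1r -(divfK q1_neq0 X) -mulrBl mulf_neq0.
by rewrite /gfun q2E; field; rewrite [q1 * X]mulrC n1 n0 q3_neq0 q1_neq0 n3.
Qed.

(** * The raising amplitudes *)

Definition e_support (f : nat -> int) i := supp (f i) i.

Definition e_amp (f : nat -> int) i : K :=
  (1 - q1)^-1 * \prod_(j < i) cf (f i - f j) (i%:Z - j%:Z).

Lemma e_amp_left f i j : (i < j)%N -> e_amp (bump f j 1) i = e_amp f i.
Proof.
move=> ij; rewrite /e_amp bump_other ?neq_ltn ?ij //; congr (_ * _).
apply: eq_bigr => k _; rewrite bump_other // neq_ltn.
by rewrite (ltn_trans (ltn_ord k) ij).
Qed.

Lemma e_amp_bump f i j d : (i < j)%N -> exists a,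
  e_amp f j = a * cf (f j - f i) (j%:Z - i%:Z)
  /\ e_amp (bump f i d) j = a * cf (f j - f i - d) (j%:Z - i%:Z).
Proof.
move=> ij; pose F k := cf (f j - f k) (j%:Z - k%:Z).
exists ((1 - q1)^-1 * \prod_(k < j | k != Ordinal ij) F k).
rewrite /e_amp !(bigD1 (Ordinal ij) isT) /=; split; first by rewrite /F; ring.
rewrite bump_same bump_other ?neq_ltn ?ij ?orbT // opprD addrA.
rewrite [cf _ _ * _]mulrC mulrA; congr (_ * _ * _); apply: eq_bigr => k ki.
by rewrite bump_other.
Qed.

Lemma e_exchange_lt f i j : (i < j)%N ->
  g (e_support f j) (e_support f i) * (e_amp f i * e_amp (bump f i 1) j)
  = - (g (e_support f i) (e_support f j) * (e_amp f j * e_amp (bump f j 1) i)).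
Proof.
move=> ij; rewrite (e_amp_left _ ij); have [a [-> ->]] := e_amp_bump f 1 ij.
have := cfactor_step (f i) (f j) ij; rewrite -!/(e_support _ _) => h.
transitivity (e_amp f i * a * (g (e_support f j) (e_support f i)
  * cf (f j - f i - 1) (j%:Z - i%:Z))); first by ring.
by rewrite h; ring.
Qed.

Lemma bump_part1 f i : is_part f -> (0 < i)%N ==> (f i != f i.-1) ->
  is_part (bump f i 1).
Proof.
move=> pf h; split; last first.
  have [M fM] := pf.2; exists (maxn M i.+1).
  by apply: bump_supp; [apply: supp_ltW fM; rewrite leq_maxl|rewrite leq_maxr].
move=> a b ab; rewrite /bump; have := pf.1 _ _ ab.
have [eb|nb] := eqVneq b i; have [ea|na] := eqVneq a i; try lia.
have ai : (a <= i.-1)%N by lia.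
have := pf.1 _ _ ai; have := pf.1 _ _ (leq_pred i); subst b.
have i0 : (0 < i)%N by lia.
by move: h; rewrite i0 /=; lia.
Qed.

Lemma bump_partN1 f i : is_part f -> f i != f i.+1 -> is_part (bump f i (-1)).
Proof.
move=> pf h; split; last first.
  have [M fM] := pf.2; exists (maxn M i.+1).
  by apply: bump_supp; [apply: supp_ltW fM; rewrite leq_maxl|rewrite leq_maxr].
move=> a b ab; rewrite /bump; have := pf.1 _ _ ab.
have [eb|nb] := eqVneq b i; have [ea|na] := eqVneq a i; try lia.
have bi : (i.+1 <= b)%N by lia.
have := pf.1 _ _ bi; have := pf.1 _ _ (leqnSn i); subst a; lia.
Qed.

Lemma e_allowed : allowed e_amp 1.
Proof.
move=> f i pf h; apply: bump_part1 => //; apply/implyP => i0.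
apply: contra h => /eqP e; have ii : (i.-1 < i)%N by rewrite prednK.
rewrite /e_amp (bigD1 (Ordinal ii) isT) /= e subrr.
by rewrite (_ : i%:Z - i.-1%:Z = 1) ?cfactor01 ?mul0r ?mulr0 //; lia.
Qed.

(** A box can only be added after its left and upper neighbours, which keeps the
    structure function of two admissible additions away from its zeros. *)
Lemma e_ladder :
  exchange_ladder (q1 + q2 + q3) (q1 * q2 + q1 * q3 + q2 * q3) q1 e_amp e_support 1.
Proof.
have gE z w := esym (gfunE z w q123).
split; first by [left]; first exact: e_allowed; rewrite ?gE //.
- by move=> f i; exact: supp_neq0.
- by move=> f i j ij; rewrite /e_support bump_other.
- by move=> f i; rewrite /e_support bump_same suppD expr1z.
- by move=> y; rewrite gE /gfun subrr !mul0r.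
- move=> y y0; rewrite gE /gfun; have yE q : y - q * (q1 * y) = (1 - q1 * q) * y by ring.
  rewrite !yE !mulf_neq0 //.
  + by have := @generic_neq1 2 0 isT; rewrite expr0z mulr1.
  + have := @generic_neq1 0 (-1) isT; rewrite expr0z mul1r exprN1 q2E.
    by rewrite invfM mulrA divff // mul1r.
  + exact: q13_sub1_neq0.
- move=> f i j pf ij; rewrite !gE; have [ij'|] := ltnP i j; first exact: e_exchange_lt.
  rewrite leq_eqVlt eq_sym (negPf ij) /= => ji.
  by rewrite (e_exchange_lt f ji) opprK.
- move=> f i j pf ij pb; rewrite gE; apply: gfun_supp_neq0.
  + by case=> _ ji; move: ij; rewrite ji eqxx.
  + case=> e ji; have := pb.1 i j; rewrite bump_same bump_other //; lia.
  + case=> e ji; have := pf.1 j i; lia.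
- move=> f i k pf ik p1 p2 p3; rewrite gE -[q1]expr1z -suppD; apply: gfun_supp_neq0.
  + by case=> _ ki; move: ik; rewrite ki eqxx.
  + case=> e ki; have := p1.1 i k; rewrite bump_same bump_other //; lia.
  + case=> e ki; have := p3.1 k i.
    have ki' : k != i by rewrite eq_sym.
    rewrite !(bump_same, bump_other _ _ ik, bump_other _ _ ki'); lia.
Qed.


(** * The lowering amplitudes *)

Definition f_support (f : nat -> int) i := supp (f i - 1) i.

Definition f_amp_cut (N : nat) (f : nat -> int) i : K :=
  (- (1 - q1^-1))^-1 * (\prod_(j < N | (i < j)%N) cf (f j - f i) (j%:Z - i%:Z)
    * beta q2 q3 u N (f_support f i)).

(** The correction [beta] is the tail of the product over rows of length zero,
    so that a further empty row leaves the corrected amplitude unchanged. *)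
Lemma beta_step N a i : (i < N)%N ->
  cf (0 - a) (N%:Z - i%:Z) * beta q2 q3 u N.+1 (supp (a - 1) i)
  = beta q2 q3 u N (supp (a - 1) i).
Proof.
move=> iN; set d := N%:Z - i%:Z; have d0 : d != 0 by rewrite /d; lia.
have d1 : d + 1 != 0 by rewrite /d; lia.
pose Y := q1 ^ (- a) * q3 ^ d.
have E : q3 ^+ N * u / supp (a - 1) i = q1 * Y.
  rewrite /supp /Y /d !expfzDr // exprN1 -!invr_expz -!exprnP.
  by field; rewrite u_neq0 q1_neq0 expfz_neq0 // expf_neq0.
rewrite cfactorE add0r -/Y /beta exprSr.
have -> : q3 ^+ N * q3 * u / supp (a - 1) i = q3 * (q1 * Y) by rewrite -E; ring.
have -> : q2 * (q3 ^+ N * q3) * u / supp (a - 1) i = q2 * q3 * (q1 * Y).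
  by rewrite -E; ring.
have -> : q2 * q3 ^+ N * u / supp (a - 1) i = q2 * (q1 * Y) by rewrite -E; ring.
rewrite E.
have n0 := @generic_neq1 (- a) d; rewrite d0 orbT in n0; have {n0} := n0 isT.
have n1 := @generic_neq1 (- a + 1) d; rewrite d0 orbT in n1; have {n1} := n1 isT.
have n2 := @generic_neq1 (- a + 1) (d + 1); rewrite d1 orbT in n2.
have {n2} := n2 isT.
rewrite ![q1 ^ (- a + _)]expfzDr // ![q3 ^ (d + _)]expfzDr // !expr1z.
have -> : q1 ^ (- a) * q1 * (q3 ^ d * q3) = q3 * (q1 * Y) by rewrite /Y; ring.
have -> : q1 ^ (- a) * q1 * q3 ^ d = q1 * Y by rewrite /Y; ring.
rewrite -/Y => n2 n1 n0; rewrite q2E; field.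
by rewrite q1_neq0 q3_neq0 n0 n1 n2.
Qed.

Lemma f_amp_cut_stable N M f i : (i < N)%N -> (N <= M)%N -> supp_lt N f ->
  f_amp_cut M f i = f_amp_cut N f i.
Proof.
move=> iN /subnK <- fN; elim: (M - N)%N => [//|m IH].
rewrite addSn -{}IH /f_amp_cut /f_support; congr (_ * _).
have im : (i < m + N)%N by rewrite (leq_trans iN) ?leq_addl.
rewrite big_mkcond big_ord_recr -big_mkcond /= im (fN (m + N)%N (leq_addl _ _)).
by rewrite -[in RHS]beta_step // mulrA.
Qed.

(** The value at all large [N] of the corrected amplitude on [W^N(u)]. *)
Definition f_amp (f : nat -> int) i : K := f_amp_cut (maxn i.+1 (cutoff f)) f i.

Lemma f_ampE N f i : supp_lt N f -> (i < N)%N -> f_amp f i = f_amp_cut N f i.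
Proof.
move=> fN iN; have fC := cutoffP fN; rewrite /f_amp.
set C := maxn i.+1 (cutoff f).
rewrite -(@f_amp_cut_stable N (maxn N C)) ?leq_maxl //.
rewrite -(@f_amp_cut_stable C (maxn N C)) ?leq_maxr ?leq_maxl //.
by apply: supp_ltW fC; rewrite leq_maxr.
Qed.

Lemma f_amp_right f i j d : (exists M, supp_lt M f) -> (i < j)%N ->
  f_amp (bump f i d) j = f_amp f j.
Proof.
case=> M fM ij; set N := maxn M j.+1.
have fN : supp_lt N f by apply: supp_ltW fM; rewrite leq_maxl.
have jN : (j < N)%N by rewrite leq_maxr.
rewrite !(@f_ampE N) //; last by apply: bump_supp => //; apply: ltn_trans jN.
rewrite /f_amp_cut /f_support bump_other ?neq_ltn ?ij ?orbT //.
congr (_ * (_ * _)); apply: eq_bigr => k jk; rewrite bump_other //.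
by rewrite neq_ltn (ltn_trans ij jk) orbT.
Qed.

Lemma f_amp_bump f i j d : (exists M, supp_lt M f) -> (i < j)%N -> exists a,
  f_amp f i = a * cf (f j - f i) (j%:Z - i%:Z)
  /\ f_amp (bump f j d) i = a * cf (f j - f i + d) (j%:Z - i%:Z).
Proof.
case=> M fM ij; set N := maxn M j.+1.
have fN : supp_lt N f by apply: supp_ltW fM; rewrite leq_maxl.
have jN : (j < N)%N by rewrite leq_maxr.
have iN := ltn_trans ij jN; pose F k := cf (f k - f i) (k%:Z - i%:Z).
rewrite !(@f_ampE N) //; last exact: bump_supp.
exists ((- (1 - q1^-1))^-1 * ((\prod_(k < N | (i < k)%N && (k != Ordinal jN)) F k)
  * beta q2 q3 u N (f_support f i))).
rewrite /f_amp_cut /f_support !(bigD1 (Ordinal jN) ij) /=; split; first by rewrite /F; ring.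
have ne : i != j by rewrite neq_ltn ij.
rewrite bump_same (bump_other _ _ ne) addrAC.
rewrite (eq_bigr (fun k : 'I_N => F k)); first by ring.
by move=> k /andP[_ kj]; rewrite bump_other.
Qed.

Lemma f_exchange_lt f i j : (exists M, supp_lt M f) -> (i < j)%N ->
  g (f_support f i) (f_support f j) * (f_amp f i * f_amp (bump f i (-1)) j)
  = - (g (f_support f j) (f_support f i) * (f_amp f j * f_amp (bump f j (-1)) i)).
Proof.
move=> fM ij; rewrite (f_amp_right _ fM ij).
have [a [-> ->]] := f_amp_bump (-1) fM ij.
have := cfactor_step (f i - 1) (f j - 1) ij; rewrite -!/(f_support _ _).
rewrite (_ : f j - 1 - (f i - 1) = f j - f i); last lia.
move=> h; transitivity (f_amp f j * a
  * - - (g (f_support f i) (f_support f j) * cf (f j - f i) (j%:Z - i%:Z))); first by ring.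
by rewrite -h; ring.
Qed.

Lemma f_allowed : allowed f_amp (-1).
Proof.
move=> f i pf h; apply: bump_partN1 => //; apply: contra h => /eqP e.
have [M fM] := pf.2; set N := maxn M i.+2.
have fN : supp_lt N f by apply: supp_ltW fM; rewrite leq_maxl.
have iN : (i.+1 < N)%N by rewrite leq_maxr.
rewrite (@f_ampE N) ?(ltnW iN) // /f_amp_cut (bigD1 (Ordinal iN) (ltnSn i)) /=.
rewrite e subrr (_ : i.+1%:Z - i%:Z = 1) ?cfactor01 ?mul0r ?mulr0 //; lia.
Qed.

(** Lowering reverses the roles of the two arguments of the structure function,
    which up to sign exchanges the two middle coefficients of the cubic. *)
Lemma f_ladder :
  exchange_ladder (q1 * q2 + q1 * q3 + q2 * q3) (q1 + q2 + q3) q1^-1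
    f_amp f_support (-1).
Proof.
have gE z w : cubic (q1 * q2 + q1 * q3 + q2 * q3) (q1 + q2 + q3) z w = - g w z.
  by rewrite gfunE // [in RHS]cubicC opprK.
split; first by [right]; first exact: f_allowed; rewrite ?invr_eq0 //.
- by move=> f i; exact: supp_neq0.
- by move=> f i j ij; rewrite /f_support bump_other.
- by move=> f i; rewrite /f_support bump_same (suppD (f i - 1) (-1)) exprN1.
- by move=> y; rewrite gE /gfun mulVKf // subrr !mul0r oppr0.
- move=> y y0; rewrite gE oppr_eq0 /gfun.
  have yE q : q1^-1 * y - q * y = q1^-1 * ((1 - q1 * q) * y).
    by field; rewrite q1_neq0.
  rewrite !yE !mulf_neq0 ?invr_eq0 //.
  + by have := @generic_neq1 2 0 isT; rewrite expr0z mulr1.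
  + have := @generic_neq1 0 (-1) isT; rewrite expr0z mul1r exprN1 q2E.
    by rewrite invfM mulrA divff // mul1r.
  + exact: q13_sub1_neq0.
- move=> f i j pf ij; rewrite !gE !mulNr opprK.
  have [ij'|] := ltnP i j; first by rewrite f_exchange_lt ?opprK //; exact: pf.2.
  rewrite leq_eqVlt eq_sym (negPf ij) /= => ji.
  by rewrite -(f_exchange_lt pf.2 ji).
- move=> f i j pf ij pb; rewrite gE oppr_eq0; apply: gfun_supp_neq0.
  + by case=> _ ji; move: ij; rewrite ji eqxx.
  + case=> e ji; have := pb.1 j i; rewrite bump_same bump_other //; lia.
  + case=> e ji; have := pf.1 i j; lia.
- move=> f i k pf ik p1 p2 p3; rewrite gE oppr_eq0 -exprN1 -suppD.
  apply: gfun_supp_neq0.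
  + by case=> _ ki; move: ik; rewrite ki eqxx.
  + case=> e ki; have := p1.1 k i; rewrite bump_same bump_other //; lia.
  + case=> e ki; have := p3.1 i k.
    have ki' : k != i by rewrite eq_sym.
    rewrite !(bump_same, bump_other _ _ ik, bump_other _ _ ki'); lia.
Qed.

Lemma q2_neq0 : q2 != 0.
Proof. by rewrite q2E invr_eq0 mulf_neq0. Qed.

Lemma suppS a i : supp a i.+1 = q3 * supp a i.
Proof. by rewrite /supp exprS; ring. Qed.

Lemma supp_pred a i : supp (a - 1) i = supp a i / q1.
Proof. by rewrite suppD // exprN1 mulrC. Qed.

Lemma supp_succ a i : supp (a + 1) i = q1 * supp a i.
Proof. by rewrite suppD // expr1z. Qed.

(** * Eigenvalues of the Cartan currents *)

(** Poles and zeros in [z] of the corrected eigenvalue: two for each row, and one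
    from the correction factor [beta]. *)
Definition psi_pole N (f : nat -> int) (k : 'I_N + 'I_N + 'I_1) : K :=
  match k with
  | inl (inl i) => supp (f i) i
  | inl (inr i) => supp (f i - 1) i
  | inr _ => supp 0 N
  end.

Definition psi_zero N (f : nat -> int) (k : 'I_N + 'I_N + 'I_1) : K :=
  match k with
  | inl (inl i) => supp (f i) i.+1
  | inl (inr i) => q3^-1 * supp (f i - 1) i
  | inr _ => q2 * supp 0 N
  end.

Arguments psi_pole : clear implicits.
Arguments psi_zero : clear implicits.

Lemma psi_pole_neq0 N f k : psi_pole N f k != 0.
Proof. by case: k => [[i|i]|i] /=. Qed.

Lemma psi_zero_neq0 N f k : psi_zero N f k != 0.
Proof.
case: k => [[i|i]|i] //=; rewrite mulf_neq0 ?invr_eq0 //; exact: q2_neq0.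
Qed.

Lemma supp_inj0 a b i j : supp a i = supp b j -> a = b /\ i = j.
Proof.
move=> h; have [|h1 h2] := @supp_inj a b i j 0 0.
  by rewrite !expr0z !mul1r.
by split; lia.
Qed.

Lemma psi_pole_inj N f : injective (psi_pole N f).
Proof.
have iN (i : 'I_N) : (i < N)%N := ltn_ord i.
case=> [[i|i]|i] [[j|j]|j] //= /supp_inj0[e1 e2].
- by congr (inl (inl _)); exact: val_inj.
- by have ij := val_inj e2; subst j; lia.
- by have := iN i; rewrite e2 ltnn.
- by have ij := val_inj e2; subst j; lia.
- by congr (inl (inr _)); exact: val_inj.
- by have := iN i; rewrite e2 ltnn.
- by have := iN j; rewrite -e2 ltnn.
- by have := iN j; rewrite -e2 ltnn.
- by rewrite !ord1.
Qed.

Definition psi_cut N f : bool -> int -> K := ratio_series (psi_pole N f) (psi_zero N f).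

Local Notation Xs c := ('X - (c)%:P).

Lemma linfac_pole N f : linfac (psi_pole N f)
  = (\prod_(i < N) (Xs (supp (f i) i) * Xs (supp (f i - 1) i))) * Xs (supp 0 N).
Proof. by rewrite /linfac !big_sumType big_ord1 /= big_split. Qed.

Lemma linfac_zero N f : linfac (psi_zero N f)
  = (\prod_(i < N) (Xs (supp (f i) i.+1) * Xs (q3^-1 * supp (f i - 1) i)))
    * Xs (q2 * supp 0 N).
Proof. by rewrite /linfac !big_sumType big_ord1 /= big_split. Qed.

(** The eigenvalue is determined by its poles and zeros, hence identities between
    eigenvalues reduce to identities between products of linear factors. *)
Lemma psi_cut_cross N M f h e G H :
  G * linfac (psi_pole M h) * linfac (psi_zero N f)
    = H * linfac (psi_pole N f) * linfac (psi_zero M h) ->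
  sact G (psi_cut N f e) = sact H (psi_cut M h e).
Proof.
have p0 := psi_pole_neq0.
apply: (sact_cross (e := e)) => //; first by exact: half_ratio_series.
- by exact: half_ratio_series.
- by apply: sact_ratio_series => //; exact: psi_pole_inj.
- by apply: sact_ratio_series => //; exact: psi_pole_inj.
Qed.

(** An empty row cancels against the change of the correction factor. *)
Lemma psi_cut_stable N M f : (N <= M)%N -> supp_lt N f -> psi_cut M f = psi_cut N f.
Proof.
move=> /subnK <- fN; elim: (M - N)%N => [//|m <-]; rewrite addSn.
apply/funext => e; rewrite -[LHS]/(fun n => psi_cut (m + N).+1 f e n).
have c1 s : sact 1 s = s :> (int -> K).
  by rewrite -polyC1 sactC; apply/funext => n; rewrite mul1r.
rewrite -[LHS]c1 -[RHS]c1; apply: psi_cut_cross.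
rewrite !linfac_pole !linfac_zero !big_ord_recr /= fN ?leq_addl //.
rewrite !suppS !supp_pred; set y := supp 0 (m + N).
have -> : q3^-1 * (y / q1) = q2 * y by rewrite q2E; field; rewrite q1_neq0 q3_neq0.
have -> : q2 * (q3 * y) = y / q1 by rewrite q2E; field; rewrite q1_neq0 q3_neq0.
set P := \prod_(i < m + N) _; set Q := \prod_(i < m + N) _.
ring.
Qed.

Definition psi_ev (f : nat -> int) : bool -> int -> K := psi_cut (cutoff f) f.

Lemma psi_evE N f : supp_lt N f -> psi_ev f = psi_cut N f.
Proof.
move=> fN; have fC := cutoffP fN; rewrite /psi_ev; set C := cutoff f in fC *.
rewrite -(@psi_cut_stable N (maxn N C)) ?leq_maxl //.
by rewrite -(@psi_cut_stable C (maxn N C)) ?leq_maxr.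
Qed.

Definition gz (x : K) : {poly K} := Xs (q1 * x) * Xs (q2 * x) * Xs (q3 * x).
Definition gw (x : K) : {poly K} := Xs (x / q1) * Xs (x / q2) * Xs (x / q3).

(** The factors of the row before and after the new box of weight [x] combine to
    [gw x / gz x], again because [q2 = (q1 q3)^-1]. *)
Lemma psi_ev_bump f i e : (exists M, supp_lt M f) ->
  sact (gz (supp (f i) i)) (psi_ev (bump f i 1) e)
  = sact (gw (supp (f i) i)) (psi_ev f e).
Proof.
case=> M fM; set N := maxn M i.+1; have iN : (i < N)%N by rewrite leq_maxr.
have fN : supp_lt N f by apply: supp_ltW fM; rewrite leq_maxl.
rewrite (psi_evE fN) (psi_evE (bump_supp 1 fN iN)); apply: psi_cut_cross.
rewrite !linfac_pole !linfac_zero !(bigD1 (Ordinal iN) isT) /= !bump_same.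
have E (F : int -> nat -> {poly K}) :
    \prod_(k < N | k != Ordinal iN) F (bump f i 1 k) k
    = \prod_(k < N | k != Ordinal iN) F (f k) k.
  by apply: eq_bigr => k ki; rewrite bump_other.
rewrite (E (fun a k => Xs (supp a k) * Xs (supp (a - 1) k))).
rewrite (E (fun a k => Xs (supp a k.+1) * Xs (q3^-1 * supp (a - 1) k))).
rewrite addrK !suppS supp_succ !supp_pred; set x := supp (f i) i.
have -> : q3^-1 * (x / q1) = q2 * x by rewrite q2E; field; rewrite q1_neq0 q3_neq0.
rewrite /gz /gw.
have -> : q3 * (q1 * x) = x / q2.
  by rewrite q2E; field; rewrite q1_neq0 q3_neq0 oner_neq0.
rewrite [q3^-1 * x]mulrC.
set P := \prod_(i < N | _) _; set Q := \prod_(i < N | _) _.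
ring.
Qed.

Lemma g_zw_eval x : map_poly (horner_eval x) (g_zw q1 q2 q3) = gz x.
Proof.
rewrite /g_zw /gpoly /gfun !rmorphM !rmorphB !rmorphM /= !map_polyX !map_polyC /=.
by rewrite /horner_eval !hornerE -!polyCM.
Qed.

Lemma g_wz_eval x : map_poly (horner_eval x) (g_wz q1 q2 q3) = - gw x.
Proof.
rewrite /g_wz /gpoly /gfun !rmorphM !rmorphB !rmorphM /= !map_polyX !map_polyC /=.
rewrite /horner_eval !hornerE /gw.
have E q : q != 0 -> x%:P - q%:P * 'X = - (q%:P * Xs (x / q)).
  by move=> q0; rewrite mulrBr -polyCM mulrCA divff // mulr1 opprB.
rewrite !E ?q2_neq0 //.
transitivity (- ((q1 * q2 * q3)%:P * (Xs (x / q1) * Xs (x / q2) * Xs (x / q3)))).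
  by rewrite !polyCM; ring.
by rewrite q123 mul1r.
Qed.

(** * The Cartan operators *)

Definition psi_op (e : bool) (n : int) : fock K -> fock K :=
  linext (fun lam : Pplus => psi_ev lam e n *: ket K lam).

HB.instance Definition _ e n := GRing.Linear.copy (psi_op e n) (linext _).

Lemma psi_opE e n f : is_part f -> psi_op e n (ket K f) = psi_ev f e n *: ket K f.
Proof. by move=> pf; have [lam ->] := is_partE pf; rewrite /psi_op linext_ketE. Qed.

Lemma smul_series (p : {poly {poly K}}) (x : K) (s : int -> K) (v : fock K) m n :
  x != 0 -> smul p (fun i j => (x ^ j * s i) *: v) m n
  = (x ^ n * sact (map_poly (horner_eval x) p) s m) *: v.
Proof.
move=> x0; rewrite (@eq_smul _ _ _ _ (fun i j => x ^ j *: (s i *: v))); last first.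
  by move=> i j; rewrite scalerA.
rewrite smul_inner // -scalerA; congr (_ *: _).
rewrite (@sactE _ (size p)) ?size_poly // scaler_suml.
by apply: eq_bigr => a _; rewrite coef_map scalerA.
Qed.

(** Each move multiplies the eigenvalue by a ratio of structure functions at the
    support of the move, which is the relation between a Cartan current and
    a ladder. *)
Lemma psi_ladder (c x : (nat -> int) -> nat -> K) d (p p' : {poly {poly K}}) f e m n :
  d = 1 \/ d = -1 -> allowed c d -> (forall h i, x h i != 0) ->
  (forall h i, is_part h ->
    sact (map_poly (horner_eval (x h i)) p) (psi_ev (bump h i d) e)
    = fun k => - sact (map_poly (horner_eval (x h i)) p') (psi_ev h e) k) ->
  is_part f ->
  smul p (fun i j => psi_op e i (ladder c x d j (ket K f))) m n
  = - smul p' (fun i j => ladder c x d j (psi_op e i (ket K f))) m n.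
Proof.
move=> d1 ca x0 hp pf; have fM := is_part_cutoff pf; set M := cutoff f in fM.
have E n' := ladderE c x n' d1 pf fM (ltnSn M).
pose T i (s : int -> K) := fun k j : int =>
  c f i *: ((x f i ^ j * s k) *: ket K (bump f i d)).
rewrite (@eq_smul _ _ p _ (fun k j => \sum_(i < M.+1) T i (psi_ev (bump f i d) e) k j));
  last first.
  move=> k j; rewrite E raddf_sum; apply: eq_bigr => i _.
  rewrite [LHS]linearZ /T /=.
  have [->|ci] := eqVneq (c f i) 0; first by rewrite mul0r !scale0r.
  by rewrite (psi_opE _ _ (ca _ _ pf ci)) !scalerA; congr (_ *: _); ring.
rewrite (@eq_smul _ _ p' _ (fun k j => \sum_(i < M.+1) T i (psi_ev f e) k j)); last first.
  move=> k j; rewrite psi_opE // [LHS]linearZ /= E scaler_sumr.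
  by apply: eq_bigr => i _; rewrite /T !scalerA; congr (_ *: _); ring.
rewrite !smul_sum -sumrN; apply: eq_bigr => i _.
by rewrite /T !smulZ !smul_series // hp // mulrN scaleNr scalerN.
Qed.

Lemma psi_e f e m n : is_part f ->
  smul (g_zw q1 q2 q3)
    (fun i j => psi_op e i (ladder e_amp e_support 1 j (ket K f))) m n
  = - smul (g_wz q1 q2 q3)
    (fun i j => ladder e_amp e_support 1 j (psi_op e i (ket K f))) m n.
Proof.
apply: psi_ladder; first by [left].
- exact: (e_allowed).
- by move=> h i; exact: supp_neq0.
move=> h i ph; rewrite g_zw_eval g_wz_eval psi_ev_bump; last exact: ph.2.
by apply/funext => k; rewrite -scaleN1r sactZ mulN1r opprK.
Qed.

Lemma psi_f f e m n : is_part f ->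
  smul (g_wz q1 q2 q3)
    (fun i j => psi_op e i (ladder f_amp f_support (-1) j (ket K f))) m n
  = - smul (g_zw q1 q2 q3)
    (fun i j => ladder f_amp f_support (-1) j (psi_op e i (ket K f))) m n.
Proof.
apply: psi_ladder; first by [right].
- exact: f_allowed.
- by move=> h i; exact: supp_neq0.
move=> h i ph; rewrite g_zw_eval g_wz_eval.
have [M hM] := ph.2; have bM : exists M, supp_lt M (bump h i (-1)).
  exists (maxn M i.+1); apply: bump_supp; last by rewrite leq_maxr.
  by apply: supp_ltW hM; rewrite leq_maxl.
have := psi_ev_bump i e bM; rewrite bump_same bumpNK => ->.
by apply/funext => k; rewrite -scaleN1r sactZ mulN1r.
Qed.

(** * The commutator of raising and lowering *)

(** Contribution to a residue at [y] of a row whose support is [z]. *)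
Definition row_factor (y z : K) : K :=
  (y - q3 * z) * (y - q2 * z) / ((y - z) * (y - z / q1)).

Lemma row_factor_left a b i j : (j < i)%N ->
  row_factor (supp a i) (supp b j) = cf (a - b) (i%:Z - j%:Z).
Proof.
move=> ji; rewrite (supp_ratio a b i j) cfactorE //.
set X := q1 ^ (a - b) * q3 ^ _; have d0 : i%:Z - j%:Z != 0 by lia.
have d0' (k : int) : (k != 0) || (i%:Z - j%:Z != 0) by rewrite d0 orbT.
have n0 : 1 - X != 0 := generic_neq1 (d0' (a - b)).
have := generic_neq1 (d0' (a - b + 1)).
rewrite [q1 ^ (a - b + 1)]expfzDr // expr1z mulrAC -/X => n1.
rewrite /row_factor q2E; set z := supp b j; have z0 : z != 0 by exact: supp_neq0.
have m1 : X * z - z != 0.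
  have -> : X * z - z = - ((1 - X) * z) by ring.
  by rewrite oppr_eq0 mulf_neq0.
have m2 : q1 * (X * z) - z != 0.
  have -> : q1 * (X * z) - z = - ((1 - X * q1) * z) by ring.
  by rewrite oppr_eq0 mulf_neq0.
by field; rewrite [q1 * X]mulrC [X * z * q1]mulrC n1 n0 q3_neq0 q1_neq0 m2 m1.
Qed.

Lemma row_factor_right a b i j : (i < j)%N ->
  row_factor (supp a i) (supp b j) = cf (b - a - 1) (j%:Z - i%:Z).
Proof.
move=> ij; rewrite (supp_ratio b a j i) cfactorE //.
set X := q1 ^ (b - a) * q3 ^ _; have d0 : j%:Z - i%:Z != 0 by lia.
have d0' (k : int) : (k != 0) || (j%:Z - i%:Z != 0) by rewrite d0 orbT.
have n0 : 1 - X != 0 := generic_neq1 (d0' (b - a)).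
have := generic_neq1 (d0' (b - a - 1)).
rewrite [q1 ^ (b - a - 1)]expfzDr // exprN1 mulrAC -/X => n1.
rewrite /row_factor q2E; set y := supp a i; have y0 : y != 0 by exact: supp_neq0.
have m1 : y - X * y != 0.
  have -> : y - X * y = (1 - X) * y by ring.
  by rewrite mulf_neq0.
have n2 : q1 - X != 0.
  have -> : q1 - X = q1 * (1 - X / q1) by field; exact: q1_neq0.
  by rewrite mulf_neq0.
have m2 : y * q1 - X * y != 0.
  have -> : y * q1 - X * y = (q1 - X) * y by ring.
  by rewrite mulf_neq0.
by field; rewrite n0 q3_neq0 q1_neq0 m2 m1 n2.
Qed.

Lemma prod_row_factor (a : int) (f : nat -> int) N (i : 'I_N) :
  \prod_(j < N | j != i) row_factor (supp a i) (supp (f j) j)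
  = (\prod_(j < i) cf (a - f j) (i%:Z - j%:Z))
    * (\prod_(j < N | (i < j)%N) cf (f j - a - 1) (j%:Z - i%:Z)).
Proof.
rewrite (bigID (fun j : 'I_N => (j < i)%N)) /=; congr (_ * _).
  rewrite (big_ord_widen_cond _ xpredT (fun j => cf (a - f j) (i%:Z - j%:Z)) (ltnW (ltn_ord i))) /=.
  apply: eq_big => [j|j /andP[_ ji]]; last exact: row_factor_left.
  by rewrite -val_eqE /= neq_ltn; case: ltngtP.
apply: eq_big => [j|j /andP[ji ij]].
  by rewrite -val_eqE /= neq_ltn; case: ltngtP.
by apply: row_factor_right; move: ji ij; rewrite -val_eqE /=; lia.
Qed.

Lemma prod_sum3 N (P : pred ('I_N + 'I_N + 'I_1)%type) (F : 'I_N + 'I_N + 'I_1 -> K) :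
  P (inr ord0) ->
  \prod_(k | P k) F k = (\prod_(j | P (inl (inl j))) F (inl (inl j)))
    * (\prod_(j | P (inl (inr j))) F (inl (inr j))) * F (inr ord0).
Proof.
move=> P0; rewrite !big_sumType /=; congr (_ * _).
by rewrite big_mkcond big_ord1 P0.
Qed.


Lemma beta_supp N x : x != 0 -> x - supp 0 N != 0 ->
  beta q2 q3 u N x = (x - q2 * supp 0 N) / (x - supp 0 N).
Proof.
move=> x0; rewrite /beta /supp expr0z mul1r => xs.
by field; rewrite xs x0.
Qed.

(** With an empty last row the pole of the correction factor is cancelled by
    a zero of that row. *)
Lemma residue_correction N f : (0 < N)%N -> f N.-1 = 0 ->
  residue (psi_pole N f) (psi_zero N f) (inr ord0) = 0.
Proof.
move=> N0 fN; have NN : (N.-1 < N)%N by rewrite prednK.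
rewrite /residue (bigD1 (inl (inl (Ordinal NN)))) //= prednK // fN.
by rewrite subrr !mul0r.
Qed.

(** The residue at an end of row is, up to the constant [g 1 1], the product of the
    amplitudes for adding a box there and removing it again. *)
Lemma residue_add N f (i : 'I_N) : supp_lt N f ->
  residue (psi_pole N f) (psi_zero N f) (inl (inl i))
  = - ((g 1 1) * supp (f i) i * (e_amp f i * f_amp (bump f i 1) i)).
Proof.
move=> fN; have iN := ltn_ord i.
rewrite (f_ampE (bump_supp 1 fN iN) iN).
rewrite /residue prod_sum3 // [X in _ / X]prod_sum3 //=.
set x := supp (f i) i.
rewrite (bigD1 i) //= [X in _ * X * _ / _](bigD1 i) //=.
rewrite [X in _ / (_ * X * _)](bigD1 i) //=.
have xpred : supp (f i - 1) i = x / q1 by exact: supp_pred.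
rewrite suppS -/x xpred.
have -> : q3^-1 * (x / q1) = q2 * x by rewrite q2E; field; rewrite q1_neq0 q3_neq0.
have eP : \prod_(j < N | j != i) (x - supp (f j) j.+1)
  * \prod_(j < N | j != i) (x - q3^-1 * supp (f j - 1) j)
  / (\prod_(j < N | j != i) (x - supp (f j) j) *
     \prod_(j < N | j != i) (x - supp (f j - 1) j))
  = \prod_(j < N | j != i) row_factor x (supp (f j) j).
  rewrite -!big_split -prodf_div; apply: eq_bigr => j _ /=.
  rewrite /row_factor suppS supp_pred //; congr (_ * (_ - _) / _).
  by rewrite q2E; field; rewrite q1_neq0 q3_neq0.
rewrite prod_row_factor in eP.
rewrite (eq_bigl (fun j : 'I_N => j != i)) //.
have xs : x - supp 0 N != 0.
  rewrite subr_eq0; apply/eqP => /(supp_inj0)[_ e].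
  by move: iN; rewrite e ltnn.
have x0 : x != 0 by exact: supp_neq0.
have -> : f_amp_cut N (bump f i 1) i = (- (1 - q1^-1))^-1
    * ((\prod_(j < N | (i < j)%N) cf (f j - f i - 1) (j%:Z - i%:Z))
       * ((x - q2 * supp 0 N) / (x - supp 0 N))).
  rewrite /f_amp_cut /f_support bump_same addrK -/x beta_supp //; congr (_ * (_ * _)).
  apply: eq_bigr => j ij; rewrite bump_other; last by rewrite neq_ltn ij orbT.
  by rewrite opprD addrA.
rewrite /e_amp; move: eP.
set A := \prod_(j < N | j != i) (x - supp (f j) j.+1).
set B := \prod_(j < N | j != i) (x - q3^-1 * supp (f j - 1) j).
set C := \prod_(j < N | j != i) (x - supp (f j) j).
set D := \prod_(j < N | j != i) (x - supp (f j - 1) j).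
set E := \prod_(j < i) _; set F := \prod_(j < N | (i < j)%N) _ => eP.
transitivity ((x - q3 * x) * (x - q2 * x) / (x - x / q1) * (A * B / (C * D))
   * ((x - q2 * supp 0 N) / (x - supp 0 N))).
  rewrite !invfM; ring.
rewrite eP; set c := (x - q2 * supp 0 N) / (x - supp 0 N).
have n1 := q1_sub1_neq0.
have nx : x * q1 - x != 0.
  have -> : x * q1 - x = - (x * (1 - q1)) by ring.
  by rewrite oppr_eq0 mulf_neq0.
rewrite /gfun q2E; field.
by rewrite q1_neq0 opprB n1 q3_neq0 nx.
Qed.

Lemma residue_remove N f (i : 'I_N) : supp_lt N f ->
  residue (psi_pole N f) (psi_zero N f) (inl (inr i))
  = (g 1 1) * supp (f i - 1) i * (f_amp f i * e_amp (bump f i (-1)) i).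
Proof.
move=> fN; have iN := ltn_ord i.
rewrite (f_ampE fN iN).
rewrite /residue prod_sum3 // [X in _ / X]prod_sum3 //=.
set y := supp (f i - 1) i.
rewrite (bigD1 i) //= [X in _ * X * _ / _](bigD1 i) //=.
rewrite [X in _ / (X * _ * _)](bigD1 i) //=.
have yE : supp (f i) i = q1 * y by rewrite /y supp_pred // mulrC divfK.
rewrite suppS -/y yE.
have -> : q3 * (q1 * y) = y / q2.
  by rewrite q2E; field; rewrite q1_neq0 q3_neq0 oner_neq0.
have eP : \prod_(j < N | j != i) (y - supp (f j) j.+1)
  * \prod_(j < N | j != i) (y - q3^-1 * supp (f j - 1) j)
  / (\prod_(j < N | j != i) (y - supp (f j) j) *
     \prod_(j < N | j != i) (y - supp (f j - 1) j))
  = \prod_(j < N | j != i) row_factor y (supp (f j) j).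
  rewrite -!big_split -prodf_div; apply: eq_bigr => j _ /=.
  rewrite /row_factor suppS supp_pred //; congr (_ * (_ - _) / _).
  by rewrite q2E; field; rewrite q1_neq0 q3_neq0.
rewrite prod_row_factor in eP.
rewrite [X in _ / (_ * X * _)](eq_bigl (fun j : 'I_N => j != i)) //.
have ys : y - supp 0 N != 0.
  rewrite subr_eq0; apply/eqP => /(supp_inj0)[_ e].
  by move: iN; rewrite e ltnn.
have y0 : y != 0 by exact: supp_neq0.
have -> : f_amp_cut N f i = (- (1 - q1^-1))^-1
    * ((\prod_(j < N | (i < j)%N) cf (f j - (f i - 1) - 1) (j%:Z - i%:Z))
       * ((y - q2 * supp 0 N) / (y - supp 0 N))).
  rewrite /f_amp_cut /f_support -/y beta_supp //; congr (_ * (_ * _)).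
  by apply: eq_bigr => j ij; congr (cf _ _); ring.
have -> : e_amp (bump f i (-1)) i = (1 - q1)^-1
    * \prod_(j < i) cf (f i - 1 - f j) (i%:Z - j%:Z).
  rewrite /e_amp bump_same; congr (_ * _); apply: eq_bigr => j _.
  by rewrite bump_other // neq_ltn ltn_ord.
move: eP.
set A := \prod_(j < N | j != i) (y - supp (f j) j.+1).
set B := \prod_(j < N | j != i) (y - q3^-1 * supp (f j - 1) j).
set C := \prod_(j < N | j != i) (y - supp (f j) j).
set D := \prod_(j < N | j != i) (y - supp (f j - 1) j).
set E := \prod_(j < i) _; set F := \prod_(j < N | (i < j)%N) _ => eP.
transitivity ((y - y / q2) * (y - q3^-1 * y) / (y - q1 * y) * (A * B / (C * D))
   * ((y - q2 * supp 0 N) / (y - supp 0 N))).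
  rewrite !invfM; ring.
rewrite eP; set c := (y - q2 * supp 0 N) / (y - supp 0 N).
have n1 := q1_sub1_neq0.
have ny : y - q1 * y != 0.
  have -> : y - q1 * y = y * (1 - q1) by ring.
  by rewrite mulf_neq0.
rewrite /gfun q2E; field.
by rewrite n1 q1_neq0 q3_neq0 ny oner_neq0.
Qed.

Local Notation E := (ladder e_amp e_support 1).
Local Notation F := (ladder f_amp f_support (-1)).

Lemma g11_neq0 : (g 1 1) != 0.
Proof.
rewrite /gfun !mulr1 !mulf_neq0 ?(q1_sub1_neq0) ?(q3_sub1_neq0) //.
exact: (q2_sub1_neq0).
Qed.

(** Moves of different rows commute, because both orders carry the same
    interaction factors. *)
Lemma ef_commute f i j : is_part f -> i != j ->
  f_amp f i * e_amp (bump f i (-1)) j = e_amp f j * f_amp (bump f j 1) i.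
Proof.
move=> pf ij; have [lt_ij|lt_ji|e] := ltngtP i j; last by rewrite e eqxx in ij.
  have [a [-> ->]] := e_amp_bump f (-1) lt_ij.
  have [b [-> ->]] :=
    f_amp_bump 1 pf.2 lt_ij.
  by rewrite opprK; ring.
rewrite (f_amp_right _ pf.2 lt_ji) mulrC.
congr (_ * _); rewrite /e_amp bump_other ?neq_ltn ?lt_ji //.
congr (_ * _); apply: eq_bigr => k _; rewrite bump_other // neq_ltn.
by rewrite (ltn_trans (ltn_ord k) lt_ji).
Qed.

(** What survives is diagonal: a sum of delta functions over the ends of the rows,
    which is the difference of the two expansions of the eigenvalue. *)
Lemma ef_commutator f m n : is_part f ->
  E m (F n (ket K f)) - F n (E m (ket K f))
  = (g 1 1)^-1 *: (psi_op true (m + n) (ket K f)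
               - psi_op false (m + n) (ket K f)).
Proof.
move=> pf; have fM := is_part_cutoff pf; set M := cutoff f in fM.
have MN : (M.+1 < M.+2)%N by [].
(* With this cutoff row [N.-1] is empty, as the residue at the pole of the
   correction factor requires. *)
set N := M.+2 in MN *; have fN : supp_lt N f by apply: supp_ltW fM; lia.
have ea := e_allowed.
have fa := f_allowed.
rewrite (ladder2E _ _ _ n m (or_intror erefl) (or_introl erefl) fa pf fM MN).
rewrite (ladder2E _ _ _ m n (or_introl erefl) (or_intror erefl) ea pf fM MN).
rewrite [X in _ - X]exchange_big -sumrB.
transitivity (\sum_(i < N) (g 1 1)^-1 *:
   ((residue (psi_pole N f) (psi_zero N f) (inl (inr i))
     * supp (f i - 1) i ^ (m + n - 1)
   + residue (psi_pole N f) (psi_zero N f) (inl (inl i))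
     * supp (f i) i ^ (m + n - 1)) *: ket K f)).
  apply: eq_bigr => i _; rewrite -sumrB (bigD1 i) //= big1 ?addr0 => [|j ji].
    rewrite bumpNK bumpK -scalerBl scalerA; congr (_ *: _).
    rewrite residue_add // residue_remove //.
    rewrite /e_support /f_support !bump_same addrK.
    have P (a : K) : a != 0 -> a ^ m * a ^ n = a * a ^ (m + n - 1).
      move=> a0; rewrite -expfzDr // -{2}[a]expr1z -expfzDr //.
      by congr (_ ^ _); lia.
    have Px := P _ (supp_neq0 (f i) i); have Py := P _ (supp_neq0 (f i - 1) i).
    pose c1 := f_amp f i * e_amp (bump f i (-1)) i.
    pose c2 := e_amp f i * f_amp (bump f i 1) i.
    transitivity (c1 * (supp (f i - 1) i ^ m * supp (f i - 1) i ^ n)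
                  - c2 * (supp (f i) i ^ m * supp (f i) i ^ n)).
      by rewrite /c1 /c2; ring.
    rewrite Px Py -/c1 -/c2; have := g11_neq0.
    move: (g 1 1) (_ ^ _) (_ ^ _) => G X Y G0.
    by field; exact: G0.
  have ij : i != j :> nat by rewrite eq_sym.
  rewrite bumpC -scalerBl /e_support /f_support !bump_other // 1?eq_sym //.
  have h := ef_commute pf ij.
  rewrite -[RHS](scale0r (ket K (bump (bump f j 1) i (-1)))); congr (_ *: _).
  transitivity ((f_amp f i * e_amp (bump f i (-1)) j - e_amp f j * f_amp (bump f j 1) i)
                * (supp (f i - 1) i ^ n * supp (f j) j ^ m)); first by ring.
  by rewrite h subrr mul0r.
rewrite -scaler_sumr -scaler_suml !psi_opE // -scalerBl; congr (_ *: (_ *: _)).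
rewrite (psi_evE fN) ratio_seriesB !big_sumType big_ord1 residue_correction //=.
  by rewrite mul0r addr0 -big_split; apply: eq_bigr => i _; rewrite addrC.
by apply: fM.
Qed.

End Amplitudes.

(** * Power series expansions of rational functions *)

Section Expansions.
Variable K : fieldType.
Implicit Types (p q : {poly K}) (a b : nat -> K).

Definition conv q a (n : nat) : K := \sum_(k < n.+1) q`_k * a (n - k)%N.

Lemma conv_poly q a n m : (n <= m)%N -> conv q a n = (q * \poly_(i < m.+1) a i)`_n.
Proof.
move=> nm; rewrite coefM; apply: eq_bigr => k _; rewrite coef_poly.
by rewrite ltnS (leq_trans (leq_subr _ _) nm).
Qed.

Lemma coefM_eq p q q' n : (forall m, (m <= n)%N -> q`_m = q'`_m) ->
  (p * q)`_n = (p * q')`_n.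
Proof. by move=> e; rewrite !coefM; apply: eq_bigr => k _; rewrite e ?leq_subr. Qed.

Lemma conv_mul p q p' q' a b : (forall n, conv q a n = p`_n) ->
  (forall n, conv q' b n = p'`_n) ->
  forall n, conv (q * q') (fun m => \sum_(k < m.+1) a k * b (m - k)%N) n = (p * p')`_n.
Proof.
move=> ea eb n; rewrite (conv_poly _ _ (leqnn n)).
set A := \poly_(i < n.+1) a i; set B := \poly_(i < n.+1) b i.
have -> : (q * q' * \poly_(i < n.+1) \sum_(k < i.+1) a k * b (i - k)%N)`_n
    = (q * q' * (A * B))`_n.
  apply: coefM_eq => m mn; rewrite coef_poly ltnS mn coefM; apply: eq_bigr => k _.
  rewrite !coef_poly !ltnS (leq_trans (leq_subr _ _) mn).
  by rewrite (leq_trans _ mn) // -ltnS.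
rewrite mulrACA [LHS]coefM [RHS]coefM; apply: eq_bigr => k _.
have kn : (k <= n)%N by rewrite -ltnS.
by rewrite -!conv_poly ?leq_subr // ea eb.
Qed.

Lemma conv_inj q a b : q`_0 != 0 -> (forall n, conv q a n = conv q b n) -> a = b.
Proof.
move=> q0 e; apply/funext => n; elim/ltn_ind: n => n IH.
have := e n; rewrite /conv !big_ord_recl !subn0.
rewrite [X in _ + X = _](eq_bigr (fun i : 'I_n => q`_(lift ord0 i) * b (n - lift ord0 i)%N)).
  by move/addIr/(mulfI q0).
by move=> i _; rewrite IH // lift0; have := ltn_ord i; lia.
Qed.

(** Long division of power series. *)
Fixpoint quot_prefix p q (n : nat) : seq K :=
  if n is n'.+1 then
    let s := quot_prefix p q n' in
    rcons s ((p`_n' - \sum_(i < n') q`_i.+1 * s`_(n' - i.+1)) / q`_0)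
  else [::].

Lemma size_quot_prefix p q n : size (quot_prefix p q n) = n.
Proof. by elim: n => //= n IH; rewrite size_rcons IH. Qed.

Lemma quot_prefix_nth p q n m : (m < n)%N ->
  (quot_prefix p q n)`_m = (quot_prefix p q m.+1)`_m.
Proof.
elim: n => // n IH; rewrite ltnS leq_eqVlt => /orP[/eqP -> //|mn].
by rewrite [LHS]/= nth_rcons size_quot_prefix mn IH.
Qed.

Lemma conv_quot p q : q`_0 != 0 -> exists a, forall n, conv q a n = p`_n.
Proof.
move=> q0; exists (fun n => (quot_prefix p q n.+1)`_n) => n.
rewrite /conv big_ord_recl subn0 /= nth_rcons size_quot_prefix ltnn eqxx.
rewrite mulrC divfK // -[RHS](subrK (\sum_(i < n) q`_i.+1 * (quot_prefix p q n)`_(n - i.+1))).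
congr (_ + _); apply: eq_bigr => i _; congr (_ * _).
have in' : (n - i.+1 < n)%N by have := ltn_ord i; lia.
by rewrite -(quot_prefix_nth p q in').
Qed.

Lemma expandsP (r : ratfun K) p q : q`_0 != 0 -> r = tofrac p / tofrac q ->
  exists a, expands r a.
Proof. by move=> q0 ->; have [a ha] := conv_quot p q0; exists a, p, q; split. Qed.

(** Both expansions solve the same convolution equation, whose leading
    coefficient is invertible. *)
Lemma expands_uniq (r : ratfun K) a b : expands r a -> expands r b -> a = b.
Proof.
case=> p [q [q0 rE ea]] [p' [q' [q0' rE' eb]]].
have n0 (t : {poly K}) : t`_0 != 0 -> tofrac t != 0.
  by rewrite tofrac_eq0; apply: contra => /eqP ->; rewrite coef0.
have cross : p * q' = p' * q.
  apply/eqP; rewrite -tofrac_eq !rmorphM /=; apply/eqP.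
  have := rE'; rewrite rE => /(congr1 (fun t => t * (tofrac q * tofrac q'))).
  rewrite mulrA divfK ?n0 // => ->.
  by rewrite [tofrac q * _]mulrC mulrA divfK ?n0.
have qq : (q * q')`_0 != 0 by rewrite coefM big_ord1 subnn mulf_neq0.
apply: (conv_inj qq) => n.
have mulE c (t t' s : {poly K}) : (forall n, conv t c n = s`_n) -> conv (t' * t) c n = (t' * s)`_n.
  move=> h; rewrite (conv_poly _ _ (leqnn n)) -mulrA; apply: coefM_eq => m mn.
  by rewrite -conv_poly // h.
by rewrite (mulE _ _ _ _ eb) mulrC (mulE _ _ _ _ ea) mulrC cross mulrC.
Qed.

Lemma expansionE (r : ratfun K) a : expands r a -> expansion r = a.
Proof.
move=> h; apply: (fun k => expands_uniq k h).
exact: (@xgetPex _ (fun=> 0) [set b | expands r b] (ex_intro _ a h)).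
Qed.

Lemma expands_mul (r r' : ratfun K) a b : expands r a -> expands r' b ->
  expands (r * r') (fun m => \sum_(k < m.+1) a k * b (m - k)%N).
Proof.
case=> p [q [q0 -> ea]] [p' [q' [q0' -> eb]]]; exists (p * p'), (q * q'); split.
- by rewrite coefM big_ord1 subnn mulf_neq0.
- by rewrite !rmorphM /= invfM mulrACA.
- exact: conv_mul.
Qed.

(** In the variable [1 / z] the linear factors [z - c i] turn into [1 - c i / z],
    which reverses the coefficients of their product. *)
Lemma coef_rev_linfac (I : Type) (r : seq I) (c : I -> K) k :
  (\prod_(i <- r) (1 - (c i)%:P * 'X))`_k
  = if (k <= size r)%N then (\prod_(i <- r) ('X - (c i)%:P))`_(size r - k) else 0.
Proof.
elim: r k => [|i r IH] k.
  by rewrite !big_nil !coefC; case: k.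
rewrite !big_cons; set P := \prod_(j <- r) _ in IH *; set Q := \prod_(j <- r) _ in IH *.
have Q0 m : (size r < m)%N -> Q`_m = 0.
  by move=> h; rewrite nth_default // /Q size_prod_XsubC.
have -> : ((1 - (c i)%:P * 'X) * P)`_k = P`_k - c i * (if k is k'.+1 then P`_k' else 0).
  by rewrite mulrBl mul1r -mulrA coefB coefCM coefXM; case: k.
have E m : (('X - (c i)%:P) * Q)`_m = (if m is m'.+1 then Q`_m' else 0) - c i * Q`_m.
  by rewrite mulrBl coefB coefXM coefCM; case: m.
rewrite E /=; case: k => [|k] /=.
  by rewrite mulr0 subr0 IH !subn0 /= (Q0 (size r).+1) // mulr0 subr0.
rewrite !IH ltnS subSS; have [kn|nk] := leqP k (size r); last first.
  by rewrite leqNgt ltnS (ltnW nk) /= mulr0 subr0.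
have [kn'|nk] := ltnP k (size r).
  by have -> : (size r - k)%N = (size r - k.+1).+1 by lia.
have -> : (size r - k)%N = 0%N by lia.
by [].
Qed.

End Expansions.

Section RatioExpansions.
Variables (K : fieldType) (I : finType) (a b : I -> K).
Hypotheses (a_inj : injective a) (a_neq0 : forall i, a i != 0).

Lemma sact_delta0 (p : {poly K}) (n : nat) : sact p (@delta0 K) (- n%:Z) = p`_n.
Proof.
rewrite (@sactE _ (maxn (size p) n.+1)) ?leq_maxl //.
have nN : (n < maxn (size p) n.+1)%N by rewrite leq_maxr.
rewrite (bigD1 (Ordinal nN)) //= /delta0 addNr eqxx mulr1 big1 ?addr0 // => k.
rewrite -val_eqE /= => kn; case: eqP; rewrite ?mulr0 //; lia.
Qed.

Lemma sact_conv (p : {poly K}) (s : int -> K) (n : nat) : (forall m, 0 < m -> s m = 0) ->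
  sact p s (- n%:Z) = conv p (fun k => s (- k%:Z)) n.
Proof.
move=> s0; rewrite (@sactE _ (maxn (size p) n.+1)) ?leq_maxl //.
rewrite (@big_ord_trim _ (fun k : nat => p`_k * s (- n%:Z + k%:Z)) _ n.+1) ?leq_maxr //.
  by apply: eq_bigr => k _; congr (_ * s _); have := ltn_ord k; lia.
by move=> k nk; rewrite s0 ?mulr0 //; lia.
Qed.

Lemma ratio_expands_neg : expands (tofrac (linfac b) / tofrac (linfac a))
  (fun n => ratio_series a b false (- n%:Z)).
Proof.
exists (linfac b), (linfac a); split=> // [|n].
  rewrite -horner_coef0 linfac_horner; apply/prodf_neq0 => i _.
  by rewrite sub0r oppr_eq0.
transitivity (sact (linfac a) (ratio_series a b false) (- n%:Z)).
  by rewrite sact_conv // => m m0; exact: ratio_series_out.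
by rewrite sact_ratio_series // sact_delta0.
Qed.

Lemma ratio_expands_pos :
  expands (tofrac (\prod_i (1 - (b i)%:P * 'X)) / tofrac (\prod_i (1 - (a i)%:P * 'X)))
    (fun n => ratio_series a b true n%:Z).
Proof.
exists (\prod_i (1 - (b i)%:P * 'X)), (\prod_i (1 - (a i)%:P * 'X)); split=> // [|n].
  rewrite -horner_coef0 horner_prod; apply/prodf_neq0 => i _.
  by rewrite !hornerE subr0 oner_neq0.
have sz : size (index_enum I) = #|I| by rewrite cardT enumT [index_enum I]unlock.
rewrite coef_rev_linfac sz -/(linfac b); set d := #|I|.
transitivity (sact (linfac a) (ratio_series a b true) (n%:Z - d%:Z)).
  rewrite (@sactE _ d.+1) ?size_linfac // [RHS](reindex_inj rev_ord_inj) /=.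
  pose F k := (\prod_i (1 - (a i)%:P * 'X))`_k * ratio_series a b true (n%:Z - k%:Z).
  transitivity (\sum_(k < minn n.+1 d.+1) F k).
    rewrite -(@big_ord_trim _ F n.+1) ?geq_minl //.
      apply: eq_bigr => k _; have := ltn_ord k; rewrite /F ltnS => kn.
      by have -> : n%:Z - k%:Z = (n - k)%N%:Z by lia.
    move=> k; rewrite geq_min => /orP[nk|dk].
      by rewrite /F ratio_series_out ?mulr0 //; lia.
    by rewrite /F coef_rev_linfac sz leqNgt dk mul0r.
  rewrite -(@big_ord_trim _ F d.+1) ?geq_minr //.
    apply: eq_bigr => k _; rewrite /F coef_rev_linfac sz -ltnS ltn_ord subSS.
    have kd := ltn_ord k; congr (_ * _).
    by have -> : n%:Z - d%:Z + (d - k)%N%:Z = n%:Z - k%:Z by lia.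
  move=> k; rewrite geq_min => /orP[nk|dk].
    by rewrite /F ratio_series_out ?mulr0 //; lia.
  by rewrite /F coef_rev_linfac sz leqNgt dk mul0r.
rewrite sact_ratio_series //; case: leqP => [nd|dn].
  have -> : n%:Z - d%:Z = - (d - n)%N%:Z by lia.
  exact: sact_delta0.
rewrite /sact big1 // => k _; rewrite /delta0; case: eqP; rewrite ?mulr0 //; lia.
Qed.

End RatioExpansions.

(** * The corrected eigenvalues as expansions *)

Section FockLimits.
Variables (K : fieldType) (q1 q2 q3 u : K).
Hypotheses (q1_neq0 : q1 != 0) (q3_neq0 : q3 != 0) (u_neq0 : u != 0).
Hypothesis q123 : q1 * q2 * q3 = 1.
Hypothesis generic : forall n m : int, q1 ^ n * q3 ^ m = 1 -> n = 0 /\ m = 0.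

Local Notation supp := (supp q1 q3 u).
Local Notation P1 c := (1 - (c)%:P * 'X).
Local Notation pole N := (@psi_pole K q1 q3 u N).
Local Notation zero N := (@psi_zero K q1 q2 q3 u N).

Lemma zvar_neq0 : zvar K != 0.
Proof. by rewrite /zvar tofrac_eq0 polyX_eq0. Qed.

Lemma factor_pos (c : K) : 1 - cst c / (zvar K)^-1 = tofrac (P1 c).
Proof. by rewrite invrK rmorphB rmorphM rmorph1. Qed.

Lemma factor_neg (c : K) : 1 - cst c / zvar K = tofrac ('X - c%:P) / zvar K.
Proof. by rewrite rmorphB mulrBl divff ?zvar_neq0. Qed.

Lemma cstM : {morph @cst K : a b / a * b}.
Proof. by move=> a b; rewrite /cst polyCM rmorphM. Qed.

Lemma cstX n : {morph @cst K : a / a ^+ n}.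
Proof. by move=> a; rewrite /cst polyC_exp rmorphXn. Qed.

Lemma psi_ratfunE N (lam : Pplus) (z : ratfun K) :
  psi_ratfun q1 q3 u (trunc N lam) z
  = (\prod_(i < N) ((1 - cst (supp (lam i) i.+1) / z)
                    * (1 - cst (q3^-1 * supp (lam i - 1) i) / z)))
    / \prod_(i < N) ((1 - cst (supp (lam i) i) / z)
                    * (1 - cst (supp (lam i - 1) i) / z)).
Proof.
rewrite /psi_ratfun -prodf_div; apply: eq_bigr => i _.
have -> : val (trunc N lam) i = lam i by rewrite /trunc SubK ffunE.
have -> : q1 ^ (lam i - 1) * q3 ^ (i.+1%:Z - 2) * u = q3^-1 * supp (lam i - 1) i.
  rewrite /supp (_ : i.+1%:Z - 2 = i%:Z - 1); last lia.
  by rewrite [q3 ^ _]expfzDr // exprN1 -exprnP; ring.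
by have -> : i.+1%:Z - 1 = i%:Z by lia.
Qed.

Lemma beta_pos N : beta (cst q2) (cst q3) (cst u) N (zvar K)^-1
  = tofrac (P1 (q2 * supp 0 N)) / tofrac (P1 (supp 0 N)).
Proof.
rewrite /beta -!factor_pos /supp expr0z mul1r -cstX -!cstM.
by congr ((1 - cst _ / _) / _); ring.
Qed.

Lemma beta_minusE (F : fieldType) (b c v z : F) N : b != 0 -> v != 0 -> c != 0 ->
  z - c ^+ N * v != 0 ->
  beta_minus b c v N z = (z - b * (c ^+ N * v)) / (z - c ^+ N * v).
Proof.
move=> b0 v0 c0 h; rewrite /beta_minus; have := expf_neq0 N c0.
move: (c ^+ N) h => a h a0; field.
by rewrite h v0 a0 b0 -opprB oppr_eq0 h.
Qed.

Lemma beta_neg N : beta_minus (cst q2) (cst q3) (cst u) N (zvar K)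
  = tofrac ('X - (q2 * supp 0 N)%:P) / tofrac ('X - (supp 0 N)%:P).
Proof.
have XE c : tofrac ('X - c%:P) = zvar K - cst c by rewrite rmorphB.
have n0 (c : K) : c != 0 -> cst c != 0 by move=> c0; rewrite /cst tofrac_eq0 polyC_eq0.
have xs : zvar K - cst (supp 0 N) != 0 by rewrite -XE tofrac_eq0 polyXsubC_eq0.
have sE : cst (supp 0 N) = cst q3 ^+ N * cst u by rewrite /supp expr0z mul1r cstM cstX.
rewrite !XE cstM sE in xs *; apply: beta_minusE; last by [].
- exact/n0/(q2_neq0 q1_neq0 q3_neq0 q123).
- exact: n0.
- exact: n0.
Qed.

Lemma ratio_cancel (F : fieldType) (a b c d z : F) : z != 0 ->
  (a / z * (b / z)) / (c / z * (d / z)) = a * b / (c * d).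
Proof.
move=> z0; rewrite !mulf_div [in LHS]invf_div mulrA divfK //.
by rewrite mulf_neq0.
Qed.

Lemma psi_ratfun_pos N (lam : Pplus) : psi_ratfun q1 q3 u (trunc N lam) (zvar K)^-1
  = tofrac (\prod_(i < N) (P1 (supp (lam i) i.+1) * P1 (q3^-1 * supp (lam i - 1) i)))
    / tofrac (\prod_(i < N) (P1 (supp (lam i) i) * P1 (supp (lam i - 1) i))).
Proof.
rewrite psi_ratfunE !rmorph_prod; congr (_ / _); apply: eq_bigr => i _.
  by rewrite !factor_pos -rmorphM.
by rewrite !factor_pos -rmorphM.
Qed.

Lemma psi_ratfun_neg N (lam : Pplus) : psi_ratfun q1 q3 u (trunc N lam) (zvar K)
  = tofrac (\prod_(i < N) (('X - (supp (lam i) i.+1)%:P) * ('X - (q3^-1 * supp (lam i - 1) i)%:P)))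
    / tofrac (\prod_(i < N) (('X - (supp (lam i) i)%:P) * ('X - (supp (lam i - 1) i)%:P))).
Proof.
rewrite psi_ratfunE !rmorph_prod -!prodf_div; apply: eq_bigr => i _.
rewrite !factor_neg !rmorphM; apply: ratio_cancel; exact: zvar_neq0.
Qed.

Lemma coef0M (p q : {poly K}) : p`_0 != 0 -> q`_0 != 0 -> (p * q)`_0 != 0.
Proof. by move=> p0 q0; rewrite -horner_coef0 hornerM !horner_coef0 mulf_neq0. Qed.

Lemma coef0_prod (I : Type) (r : seq I) (F : I -> {poly K}) :
  (forall i, (F i)`_0 != 0) -> (\prod_(i <- r) F i)`_0 != 0.
Proof.
move=> F0; elim/big_ind: _ => // [|p q]; last exact: coef0M.
by rewrite coefC oner_neq0.
Qed.

Lemma P1_coef0 (c : K) : (P1 c)`_0 != 0.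
Proof. by rewrite -horner_coef0 !hornerE subr0 oner_neq0. Qed.

Lemma XsubC_coef0 (c : K) : c != 0 -> ('X - c%:P)`_0 != 0.
Proof. by move=> c0; rewrite coefB coefX coefC sub0r oppr_eq0. Qed.

Lemma prod_rows N (F : K -> {poly K}) (c : 'I_N + 'I_N + 'I_1 -> K) :
  \prod_k F (c k)
  = (\prod_(i < N) (F (c (inl (inl i))) * F (c (inl (inr i))))) * F (c (inr ord0)).
Proof. by rewrite !big_sumType big_ord1 /= big_split. Qed.

Lemma tofrac_ratioM (a b c d : {poly K}) :
  tofrac (a * b) / tofrac (c * d) = tofrac b / tofrac d * (tofrac a / tofrac c).
Proof. by rewrite mulf_div -!rmorphM [b * a]mulrC [d * c]mulrC. Qed.

(** The coefficients of the two factors convolve to those of their product, whose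
    expansion is the partial fraction series. *)
Lemma psi_pos_expansion N (lam : Pplus) (n : nat) :
  \sum_(k < n.+1) expand_pos (beta (cst q2) (cst q3) (cst u) N) k
     * expand_pos (psi_ratfun q1 q3 u (trunc N lam)) (n - k)%N
  = psi_cut q1 q2 q3 u N lam true n.
Proof.
have [b hb] := expandsP (P1_coef0 (supp 0 N)) (beta_pos N).
have Q0 : (\prod_(i < N) (P1 (supp (lam i) i) * P1 (supp (lam i - 1) i)))`_0 != 0.
  by apply: coef0_prod => i; apply: coef0M; exact: P1_coef0.
have [p hp] := expandsP Q0 (psi_ratfun_pos N lam).
rewrite /expand_pos (expansionE hb) (expansionE hp).
have pinj : injective (pole N lam) by exact: psi_pole_inj.
have pn0 k : pole N lam k != 0 by exact: psi_pole_neq0.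
have := ratio_expands_pos (zero N lam) pinj pn0.
rewrite !(prod_rows (fun c => P1 c)) tofrac_ratioM -beta_pos -psi_ratfun_pos => h.
have := expands_uniq (expands_mul hb hp) h.
by move/(congr1 (fun s => s n)).
Qed.

Lemma psi_neg_expansion N (lam : Pplus) (n : nat) :
  \sum_(k < n.+1) expand_neg (beta_minus (cst q2) (cst q3) (cst u) N) k
     * expand_neg (psi_ratfun q1 q3 u (trunc N lam)) (n - k)%N
  = psi_cut q1 q2 q3 u N lam false (- n%:Z).
Proof.
have s0 a i : supp a i != 0 by exact: supp_neq0.
have [b hb] := expandsP (XsubC_coef0 (s0 0 N)) (beta_neg N).
have Q0 : (\prod_(i < N) (('X - (supp (lam i) i)%:P)
                          * ('X - (supp (lam i - 1) i)%:P)))`_0 != 0.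
  by apply: coef0_prod => i; apply: coef0M; apply: XsubC_coef0.
have [p hp] := expandsP Q0 (psi_ratfun_neg N lam).
rewrite /expand_neg (expansionE hb) (expansionE hp).
have pinj : injective (pole N lam) by exact: psi_pole_inj.
have pn0 k : pole N lam k != 0 by exact: psi_pole_neq0.
have := ratio_expands_neg (zero N lam) pinj pn0.
rewrite /linfac !(prod_rows (fun c => 'X - c%:P)) tofrac_ratioM -beta_neg -psi_ratfun_neg => h.
have := expands_uniq (expands_mul hb hp) h.
by move/(congr1 (fun s => s n)).
Qed.

End FockLimits.

(** * Stabilization of the corrected operators *)

Section Limits.
Variables (K : fieldType) (q1 q2 q3 u : K).
Hypotheses (q1_neq0 : q1 != 0) (q3_neq0 : q3 != 0) (u_neq0 : u != 0).
Hypothesis q123 : q1 * q2 * q3 = 1.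
Hypothesis generic : forall n m : int, q1 ^ n * q3 ^ m = 1 -> n = 0 /\ m = 0.

Definition represents N (a : W K N) (b : fock K) :=
  exists2 w : Wplus K N, Wplus_incl w = a & to_fock w = b.

Lemma representsZ N c (a : W K N) b : represents a b -> represents (c *: a) (c *: b).
Proof.
by case=> w <- <-; exists (c *: w); rewrite /Wplus_incl /to_fock linearZ.
Qed.

Lemma represents0 N : represents (0 : W K N) 0.
Proof. by exists 0; rewrite /Wplus_incl /to_fock raddf0. Qed.

Lemma represents_sum N (I : Type) (r : seq I) (a : I -> W K N) (b : I -> fock K) :
  (forall i, represents (a i) (b i)) ->
  represents (\sum_(i <- r) a i) (\sum_(i <- r) b i).
Proof.
move=> h; elim/big_ind2: _ => [||i _]; [exact: represents0| |exact: h].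
move=> x y z t [w <- <-] [w' <- <-]; exists (w + w');
  by rewrite /Wplus_incl /to_fock raddfD.
Qed.

Lemma represents_ket N (f : nat -> int) (m : PN N) : is_part f -> supp_lt N f ->
  (forall i : 'I_N, val m i = f i) -> represents (<< m >> : W K N) (ket K f).
Proof.
move=> pf fN mf; have nn : nonneg m.
  by apply/forallP => i; apply/implyP => _; rewrite mf; exact: is_part_ge0.
exists (<< (Sub m nn : PNplus N) >> : Wplus K N).
  by rewrite /Wplus_incl linext_ket SubK.
rewrite /to_fock linext_ket -ket_Pplus; congr (ket K _).
apply/funext => i /=; have [iN|Ni] := ltnP i N; last by rewrite pad_out // fN.
by rewrite (padE _ (Ordinal iN)); exact: mf.
Qed.

Lemma represents_trunc N (lam : Pplus) : supp_lt N lam ->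
  represents (<< trunc N lam >> : W K N) (ket K lam).
Proof.
move=> lN; apply: represents_ket => //; first exact: Pplus_is_part.
by move=> i; rewrite /trunc SubK ffunE.
Qed.

(** The vanishing of amplitudes matters here: removing a box from the empty last
    row leads to a ket of [W N] which has no counterpart in the Fock space. *)
Lemma represents_shift N (lam : Pplus) (i : 'I_N) (d : int) (c : K) : supp_lt N lam ->
  (c != 0 -> is_part (bump lam i d)) ->
  represents (c *: shift K (trunc N lam) i d) (c *: ket K (bump lam i d)).
Proof.
move=> lN; have [->|c0] := eqVneq c 0; first by move=> _; rewrite !scale0r; exact: represents0.
move=> /(_ isT) pb; apply: representsZ; rewrite /shift.
have fE : [ffun j => val (trunc N lam) j + (if j == i then d else 0)]
    = [ffun j : 'I_N => bump lam i d j].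
  by apply/ffunP => j; rewrite !ffunE.
rewrite fE; have dm : dominant [ffun j : 'I_N => bump lam i d j].
  apply/forallP => a; apply/forallP => b; apply/implyP => ab.
  by rewrite !ffunE; exact: pb.1.
rewrite insubT /=; apply: represents_ket => //; first exact: bump_supp.
by move=> j; rewrite SubK ffunE.
Qed.

Local Notation E := (ladder (e_amp q1 q3) (e_support q1 q3 u) 1).
Local Notation F := (ladder (f_amp q1 q2 q3 u) (f_support q1 q3 u) (-1)).

Lemma fock_lim_e (lam : Pplus) :
  fock_lim (fun N => W_e q1 q3 u (trunc N lam)) (fun n => E n (ket K lam)).
Proof.
have pl := Pplus_is_part lam; have lM := is_part_cutoff pl.
exists (cutoff lam).+1 => N MN n; apply: (_ : represents _ _).
rewrite (ladderE _ _ n (or_introl erefl) pl lM MN) /W_e scaler_sumr.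
apply: represents_sum => i; rewrite scalerA.
have lE (j : 'I_N) : val (trunc N lam) j = lam j by rewrite /trunc SubK ffunE.
have -> : (1 - q1)^-1 * (\prod_(j < N | (j < i)%N)
      cfactor q1 q3 (val (trunc N lam) i - val (trunc N lam) j) (i%:Z - j%:Z)
    * (q1 ^ val (trunc N lam) i * q3 ^+ i * u) ^ n)
  = e_amp q1 q3 lam i * e_support q1 q3 u lam i ^ n.
  rewrite mulrA lE /e_amp; congr (_ * _ * _).
  rewrite (big_ord_widen _ (fun j => cfactor q1 q3 (lam i - lam j) (i%:Z - j%:Z))
    (ltnW (ltn_ord i))).
  by apply: eq_bigr => j _; rewrite lE.
apply: represents_shift; first exact: supp_ltW (ltnW MN) lM.
by rewrite mulf_eq0 negb_or => /andP[h _]; exact: (e_allowed q1_neq0 q3_neq0 u_neq0 pl h).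
Qed.

Lemma fock_lim_f (lam : Pplus) :
  fock_lim (fun N => W_fN q1 q2 q3 u (trunc N lam)) (fun n => F n (ket K lam)).
Proof.
have pl := Pplus_is_part lam; have lM := is_part_cutoff pl.
exists (cutoff lam).+1 => N MN n; apply: (_ : represents _ _).
have lN := supp_ltW (ltnW MN) lM.
rewrite (ladderE _ _ n (or_intror erefl) pl lM MN) /W_fN scaler_sumr.
apply: represents_sum => i; rewrite scalerA.
have lE (j : 'I_N) : val (trunc N lam) j = lam j by rewrite /trunc SubK ffunE.
have fE : f_amp q1 q2 q3 u lam i = f_amp_cut q1 q2 q3 u N lam i by exact: f_ampE.
have -> : (- (1 - q1^-1))^-1 * (f_coef q1 q3 (trunc N lam) i
    * beta q2 q3 u N (Defs.f_supp q1 q3 u (trunc N lam) i)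
    * Defs.f_supp q1 q3 u (trunc N lam) i ^ n)
  = f_amp q1 q2 q3 u lam i * f_support q1 q3 u lam i ^ n.
  rewrite fE /f_amp_cut /f_coef /Defs.f_supp /f_support !mulrA !lE.
  congr (_ * _ * _ * _); congr (_ * _).
  by apply: eq_bigr => j _; rewrite !lE.
apply: represents_shift => //.
rewrite mulf_eq0 negb_or => /andP[h _].
exact: (f_allowed q1_neq0 q3_neq0 u_neq0 q123 generic pl h).
Qed.

Lemma fock_lim_psip (lam : Pplus) :
  fock_lim (fun N => W_psipN q1 q2 q3 u (trunc N lam))
    (fun n => if 0 <= n then psi_op q1 q2 q3 u true n (ket K lam) else 0).
Proof.
have pl := Pplus_is_part lam; have lM := is_part_cutoff pl.
exists (cutoff lam) => N MN n; apply: (_ : represents _ _).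
have lN := supp_ltW MN lM.
rewrite /W_psipN; case: ifP => n0; last exact: represents0.
have -> : \sum_(k < `|n|%N.+1) expand_pos (beta (cst q2) (cst q3) (cst u) N) k
      *: W_psip q1 q3 u (trunc N lam) (n - k%:Z)
    = psi_cut q1 q2 q3 u N lam true n *: (<< trunc N lam >> : W K N).
  have nE : n = `|n|%N :> int by lia.
  rewrite [in RHS]nE -psi_pos_expansion // scaler_suml; apply: eq_bigr => k _.
  have kn := ltn_ord k; rewrite /W_psip (_ : 0 <= n - k%:Z); last lia.
  by rewrite scalerA (_ : `|n - k%:Z|%N = (`|n|%N - k)%N) //; lia.
rewrite psi_opE // (psi_evE q1_neq0 q3_neq0 u_neq0 q123 generic lN).
by apply: representsZ; exact: represents_trunc.
Qed.

Lemma fock_lim_psim (lam : Pplus) :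
  fock_lim (fun N => W_psimN q1 q2 q3 u (trunc N lam))
    (fun n => if n <= 0 then psi_op q1 q2 q3 u false n (ket K lam) else 0).
Proof.
have pl := Pplus_is_part lam; have lM := is_part_cutoff pl.
exists (cutoff lam) => N MN n; apply: (_ : represents _ _).
have lN := supp_ltW MN lM.
rewrite /W_psimN; case: ifP => n0; last exact: represents0.
have -> : \sum_(k < `|n|%N.+1) expand_neg (beta_minus (cst q2) (cst q3) (cst u) N) k
      *: W_psim q1 q3 u (trunc N lam) (n + k%:Z)
    = psi_cut q1 q2 q3 u N lam false n *: (<< trunc N lam >> : W K N).
  have nE : n = - (`|n|%N)%:Z by lia.
  rewrite [in RHS]nE -psi_neg_expansion // scaler_suml; apply: eq_bigr => k _.
  have kn := ltn_ord k; rewrite /W_psim (_ : n + k%:Z <= 0); last lia.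
  by rewrite scalerA (_ : absz (n + k%:Z)%R = (`|n|%N - k)%N) //; lia.
rewrite psi_opE // (psi_evE q1_neq0 q3_neq0 u_neq0 q123 generic lN).
by apply: representsZ; exact: represents_trunc.
Qed.

End Limits.

(** * Modules from actions of the generators *)

Section WordAction.
Variables (K : fieldType) (V : lmodType K) (op : gen -> V -> V).
Hypothesis op_linear : forall x, linear (op x).

Definition word_act (m : seq gen) (v : V) : V := foldr op v m.

Lemma word_act_linear m : linear (word_act m).
Proof. by elim: m => [//|x m IH] k v w; rewrite /= IH op_linear. Qed.

Definition free_act (a : free_alg K) (v : V) : V :=
  linext (fun m : {fmonom gen} => word_act m v) a.

Lemma free_actE a v : free_act a v = \sum_(m <- msupp a) a@_m *: word_act m v.
Proof. by []. Qed.

Lemma free_act_linear_l v : linear (free_act^~ v).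
Proof. exact: linext_linear. Qed.

Lemma free_act_linear_r a : linear (free_act a).
Proof.
move=> k v w; rewrite !free_actE scaler_sumr -big_split; apply: eq_bigr => m _.
by rewrite word_act_linear scalerDr !scalerA mulrC.
Qed.

Lemma free_actU c m v : free_act << c *g m >> v = c *: word_act m v.
Proof.
by rewrite /free_act (linextEw _ (msuppU_le)) big_seq_fset1 mcoeffUU.
Qed.

Lemma free_actD a b v : free_act (a + b) v = free_act a v + free_act b v.
Proof. by have := free_act_linear_l v 1 a b; rewrite !scale1r. Qed.

Lemma free_act0 v : free_act 0 v = 0.
Proof. by apply: (addrI (free_act 0 v)); rewrite -free_actD !addr0. Qed.

Lemma free_actZ k a v : free_act (k *: a) v = k *: free_act a v.
Proof. by have := free_act_linear_l v k a 0; rewrite free_act0 !addr0. Qed.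

Lemma free_actN a v : free_act (- a) v = - free_act a v.
Proof. by apply: (addrI (free_act a v)); rewrite -free_actD !subrr free_act0. Qed.

Lemma free_act_sum (I : Type) (r : seq I) (F : I -> free_alg K) v :
  free_act (\sum_(i <- r) F i) v = \sum_(i <- r) free_act (F i) v.
Proof.
elim: r => [|i r IH]; first by rewrite !big_nil free_act0.
by rewrite !big_cons free_actD IH.
Qed.

Lemma free_act1 v : free_act 1 v = v.
Proof.
have -> : (1 : free_alg K) = << 1 *g (mone : {fmonom gen}) >> by [].
by rewrite free_actU scale1r /word_act fm1.
Qed.

Lemma free_actM a b v : free_act (a * b) v = free_act a (free_act b v).
Proof.
have -> : a * b = \sum_(k <- msupp a) \sum_(l <- msupp b) << a@_k * b@_l *g mmul k l >>.
  exact: malgME.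
rewrite free_act_sum free_actE; apply: eq_bigr => k _.
rewrite free_act_sum (free_actE b).
have wZ c w : word_act k (c *: w) = c *: word_act k w.
  have w0 : word_act k 0 = 0.
    have := word_act_linear k 1 0 0; rewrite !scale1r addr0 => h.
    by apply: (addrI (word_act k 0)); rewrite -h addr0.
  by have := word_act_linear k c w 0; rewrite w0 !addr0.
have wD u w : word_act k (u + w) = word_act k u + word_act k w.
  by have := word_act_linear k 1 u w; rewrite !scale1r.
have w0 : word_act k 0 = 0 by have := wZ 0 0; rewrite !scale0r.
rewrite (big_morph _ wD w0) scaler_sumr; apply: eq_bigr => l _.
by rewrite free_actU wZ scalerA /word_act fmM foldr_cat.
Qed.

Lemma free_act_gen x v : free_act (fgen K x) v = op x v.
Proof. by rewrite /fgen free_actU scale1r /word_act fmU. Qed.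

Lemma free_act_smul p (X : int -> int -> free_alg K) m n v :
  free_act (smul p X m n) v = smul p (fun i j => free_act (X i j) v) m n.
Proof.
rewrite /smul free_act_sum; apply: eq_bigr => a _.
by rewrite free_act_sum; apply: eq_bigr => b _; rewrite free_actZ.
Qed.

Lemma free_act_comm a b v :
  free_act (comm a b) v = free_act a (free_act b v) - free_act b (free_act a v).
Proof. by rewrite /comm free_actD free_actN !free_actM. Qed.

(** Form in which the quadratic relations are verified on a vector. *)
Lemma free_act_smulN p p' (X Y : int -> int -> free_alg K) (X' Y' : int -> int -> V) m n v :
  (forall i j, free_act (X i j) v = X' i j) -> (forall i j, free_act (Y i j) v = Y' i j) ->
  smul p X' m n = - smul p' Y' m n ->
  free_act (smul p X m n) v = free_act (- smul p' Y m n) v.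
Proof.
move=> hX hY e; rewrite free_actN !free_act_smul.
by rewrite (eq_smul p m n hX) (eq_smul p' m n hY).
Qed.

Lemma free_act_double_comm a b c (A B C : V -> V) v :
  free_act a =1 A -> free_act b =1 B -> free_act c =1 C ->
  free_act (comm a (comm b c)) v
  = A (B (C v)) - A (C (B v)) - B (C (A v)) + C (B (A v)).
Proof.
move=> hA hB hC; rewrite free_act_comm !(free_act_comm b) !hA !hB !hC opprB addrA addrAC.
have -> : A (B (C v) - C (B v)) = A (B (C v)) - A (C (B v)).
  have := free_act_linear_r a (-1) (C (B v)) (B (C v)); rewrite !hA !scaleN1r.
  by rewrite ![- _ + _]addrC.
by rewrite addrAC.
Qed.

Variable rel : free_alg K -> free_alg K -> Prop.
Hypothesis proper : ~ rel_ideal rel 1.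
Hypothesis rel_act : forall x y v, rel x y -> free_act x v = free_act y v.

Definition quot_act (x : quot_alg proper) (v : V) : V := free_act (quot_repr x) v.

Lemma ideal_act0 x v : rel_ideal rel x -> free_act x v = 0.
Proof.
move=> h; elim: h v => [a y z b r v||y z _ hy _ hz v].
- rewrite !free_actM free_actD free_actN (rel_act _ r) subrr.
  have := free_act_linear_r a (-1) 0 0.
  by rewrite scaler0 addr0 => {1}->; rewrite scaleN1r addNr.
- by move=> v; rewrite free_act0.
- by rewrite free_actD hy hz addr0.
Qed.

Lemma quot_act_pi a v : quot_act (quot_pi proper a) v = free_act a v.
Proof.
apply/eqP; rewrite -subr_eq0 -free_actN -free_actD; apply/eqP.
exact/ideal_act0/repr_quot_pi.
Qed.

Lemma quot_act_module : is_module quot_act.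
Proof.
split=> [v k x y|a|v|a b v].
- rewrite -[x in LHS]quot_reprK -[y in LHS]quot_reprK -linearP quot_act_pi.
  exact: free_act_linear_l.
- exact: free_act_linear_r.
- by rewrite -(rmorph1 (quot_pi proper)) quot_act_pi free_act1.
- rewrite -[a in LHS]quot_reprK -[b in LHS]quot_reprK -rmorphM quot_act_pi.
  exact: free_actM.
Qed.

End WordAction.

(** * The Fock module *)

Section FockModule.
Variables (K : fieldType) (q1 q2 q3 u : K).
Hypotheses (q1_neq0 : q1 != 0) (q3_neq0 : q3 != 0) (u_neq0 : u != 0).
Hypothesis q123 : q1 * q2 * q3 = 1.
Hypothesis generic : forall n m : int, q1 ^ n * q3 ^ m = 1 -> n = 0 /\ m = 0.
Hypothesis six_neq0 : 6%:R != 0 :> K.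

Local Notation E := (ladder (e_amp q1 q3) (e_support q1 q3 u) 1).
Local Notation F := (ladder (f_amp q1 q2 q3 u) (f_support q1 q3 u) (-1)).
Local Notation Psi := (psi_op q1 q2 q3 u).

Definition fock_gen (x : gen) : fock K -> fock K :=
  match x with
  | gen_e i => E i
  | gen_f i => F i
  | gen_psip j => Psi true j%:Z
  | gen_psim j => Psi false (- j%:Z)
  | gen_psip0V => id
  | gen_psim0V => fun v => q2^-1 *: v
  end.

Lemma fock_gen_linear x : linear (fock_gen x).
Proof.
by case: x => [i|i|j|j||] //=; exact: linearP.
Qed.

Local Notation act := (free_act fock_gen).

Lemma act_linear a : linear (act a).
Proof. exact/free_act_linear_r/fock_gen_linear. Qed.

Lemma psi_op_out (s : bool) n v : (if s then n < 0 else 0 < n) -> Psi s n v = 0.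
Proof.
move=> hn; rewrite /psi_op /linext big1 // => lam _.
by rewrite /psi_ev /psi_cut ratio_series_out // scale0r scaler0.
Qed.

Lemma act_e i v : act (fe K i) v = E i v.
Proof. exact: free_act_gen. Qed.

Lemma act_f i v : act (ff K i) v = F i v.
Proof. exact: free_act_gen. Qed.

Lemma act_psi s i v : act (fpsi K s i) v = Psi s i v.
Proof.
case: s; rewrite /fpsi /fpsip /fpsim; case: ifP => hi.
- by rewrite free_act_gen /=; congr (Psi _ _ _); lia.
- by rewrite free_act0 psi_op_out //; lia.
- by rewrite free_act_gen /=; congr (Psi _ _ _); lia.
- by rewrite free_act0 psi_op_out //; lia.
Qed.

Lemma Psi0 s v : Psi s 0 v = (if s then 1 else q2) *: v.
Proof.
apply: (@linear_ket_eq _ _ (Psi s 0) (fun v => (if s then 1 else q2) *: v)).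
- exact: linearP.
- by move=> k w w'; rewrite scalerDr !scalerA mulrC.
move=> f pf; rewrite psi_opE //; congr (_ *: _); rewrite /psi_ev /psi_cut.
case: s; first exact: ratio_series_pos0.
have pinj : injective (@psi_pole K q1 q3 u (cutoff f) f) by exact: psi_pole_inj.
have pn0 k : @psi_pole K q1 q3 u (cutoff f) f k != 0 by exact: psi_pole_neq0.
have zn0 k : @psi_zero K q1 q2 q3 u (cutoff f) f k != 0.
  exact: (psi_zero_neq0 q1_neq0 q3_neq0 u_neq0 q123).
rewrite (ratio_series_neg0 pinj pn0 zn0).
rewrite !big_sumType big_ord1 /= -big_split big1 ?mul1r => [|i _] /=.
  by rewrite mulfK // supp_neq0.
have n1 := supp_neq0 q1_neq0 q3_neq0 u_neq0 (f i) i.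
have n2 := supp_neq0 q1_neq0 q3_neq0 u_neq0 (f i - 1) i.
by rewrite suppS !mulfK // divff.
Qed.

Lemma act_rel x y v : E_rel q1 q2 q3 x y -> act x v = act y v.
Proof.
have gE z w := gfunE z w q123.
have zwE z w : (g_zw q1 q2 q3).[z%:P].[w] = gfun q1 q2 q3 z w.
  by rewrite /g_zw /gpoly /gfun !hornerE.
have wzE z w : (g_wz q1 q2 q3).[z%:P].[w] = gfun q1 q2 q3 w z.
  by rewrite /g_wz /gpoly /gfun !hornerE.
have eL := e_ladder q1_neq0 q3_neq0 u_neq0 q123 generic.
have fL := f_ladder q1_neq0 q3_neq0 u_neq0 q123 generic.
move=> r; apply: linear_ket_eq; try exact: act_linear.
have am := free_actM fock_gen_linear; have ac := free_act_comm fock_gen_linear.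
case: r => [m n|m n|s m n|s m n|m n|s t i j|s|s||] f pf.
- apply: (@free_act_smulN _ _ _ _ _ _ _ (fun i j => E i (E j (ket K f)))
    (fun i j => E j (E i (ket K f)))) => [i j|i j|]; try by rewrite am !act_e.
  by apply: (ladder_quadratic (e := 1) eL) => // z w; rewrite mul1r ?zwE ?wzE gE.
- apply: (@free_act_smulN _ _ _ _ _ _ _ (fun i j => F i (F j (ket K f)))
    (fun i j => F j (F i (ket K f)))) => [i j|i j|]; try by rewrite am !act_f.
  apply: (ladder_quadratic (e := -1) fL) => // z w.
    by rewrite wzE gE cubicC mulN1r.
  by rewrite zwE gE cubicC mulN1r.
- apply: (@free_act_smulN _ _ _ _ _ _ _ (fun i j => Psi s i (E j (ket K f)))
    (fun i j => E j (Psi s i (ket K f)))) => [i j|i j|]; try by rewrite am act_psi act_e.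
  exact: psi_e.
- apply: (@free_act_smulN _ _ _ _ _ _ _ (fun i j => Psi s i (F j (ket K f)))
    (fun i j => F j (Psi s i (ket K f)))) => [i j|i j|]; try by rewrite am act_psi act_f.
  exact: psi_f.
- rewrite ac !act_e !act_f free_actZ free_actD free_actN.
  rewrite -[fpsip]/(fun K => fpsi K true) -[fpsim]/(fun K => fpsi K false) !act_psi.
  exact: ef_commutator.
- rewrite ac !act_psi [RHS]free_act0 !psi_opE // [X in X - _]linearZ [X in _ - X]linearZ /=.
  by rewrite !psi_opE // !scalerA mulrC subrr.
- rewrite am act_psi free_act_gen Psi0 free_act1; case: s => /=; first by rewrite scale1r.
  by rewrite scalerA divff ?scale1r // (q2_neq0 q1_neq0 q3_neq0 q123).
- rewrite am free_act_gen act_psi Psi0 free_act1; case: s => /=; first by rewrite scale1r.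
  by rewrite scalerA mulVf ?scale1r // (q2_neq0 q1_neq0 q3_neq0 q123).
- rewrite (free_act_double_comm fock_gen_linear _ (act_e 0) (act_e 1) (act_e (-1))).
  by rewrite [RHS]free_act0; exact: (ladder_serre eL).
- rewrite (free_act_double_comm fock_gen_linear _ (act_f 0) (act_f 1) (act_f (-1))).
  by rewrite [RHS]free_act0; exact: (ladder_serre fL).
Qed.

Definition fock_act : algE q1 q2 q3 -> fock K -> fock K :=
  @quot_act _ _ fock_gen _ (@E_rel_proper K q1 q2 q3).

Lemma fock_act_module : is_module fock_act.
Proof. exact/quot_act_module/act_rel/fock_gen_linear. Qed.

Lemma fock_actE a v : fock_act (E_pi q1 q2 q3 a) v = act a v.
Proof. exact/quot_act_pi/act_rel/fock_gen_linear. Qed.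

Lemma eq_fock_lim (x : forall N, int -> W K N) (y y' : int -> fock K) :
  (forall n, y n = y' n) -> fock_lim x y -> fock_lim x y'.
Proof. by move=> e; have -> : y' = y by apply/funext => n. Qed.

Theorem fock_space_module :
  exists rho : algE q1 q2 q3 -> fock K -> fock K,
    [/\ is_module rho,
        forall lam : Pplus,
          [/\ fock_lim (fun N => W_e q1 q3 u (trunc N lam))
                       (fun n => rho (E_e q1 q2 q3 n) << lam >>),
              fock_lim (fun N => W_fN q1 q2 q3 u (trunc N lam))
                       (fun n => rho (E_f q1 q2 q3 n) << lam >>),
              fock_lim (fun N => W_psipN q1 q2 q3 u (trunc N lam))
                       (fun n => rho (E_psip q1 q2 q3 n) << lam >>)
            & fock_lim (fun N => W_psimN q1 q2 q3 u (trunc N lam))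
                       (fun n => rho (E_psim q1 q2 q3 n) << lam >>)]
      & has_level rho 1 q2].
Proof.
exists fock_act; split; first exact: fock_act_module; last first.
  split=> v; rewrite fock_actE.
    by rewrite -[fpsip K 0]/(fpsi K true 0) act_psi Psi0.
  by rewrite -[fpsim K 0]/(fpsi K false 0) act_psi Psi0.
move=> lam; split.
- apply: (eq_fock_lim _ (fock_lim_e q1_neq0 q3_neq0 u_neq0 lam)) => n.
  by rewrite fock_actE act_e ket_Pplus.
- apply: (eq_fock_lim _ (fock_lim_f q1_neq0 q3_neq0 u_neq0 q123 generic lam)) => n.
  by rewrite fock_actE act_f ket_Pplus.
- apply: (eq_fock_lim _ (fock_lim_psip q1_neq0 q3_neq0 u_neq0 q123 generic lam)) => n.
  rewrite fock_actE -[fpsip K n]/(fpsi K true n) act_psi ket_Pplus.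
  by case: ifP => // n0; rewrite psi_op_out //; lia.
- apply: (eq_fock_lim _ (fock_lim_psim q1_neq0 q3_neq0 u_neq0 q123 generic lam)) => n.
  rewrite fock_actE -[fpsim K n]/(fpsi K false n) act_psi ket_Pplus.
  by case: ifP => // n0; rewrite psi_op_out //; lia.
Qed.

End FockModule.

Theorem theorem4p3 (R : realType) (q1 q2 q3 u : R[i])
  (q1_neq0 : q1 != 0) (q2_neq0 : q2 != 0) (q3_neq0 : q3 != 0) (u_neq0 : u != 0)
  (q1_neq1 : q1 != 1) (q2_neq1 : q2 != 1) (q3_neq1 : q3 != 1)
  (q123 : q1 * q2 * q3 = 1)
  (generic : forall n m : int, q1 ^ n * q3 ^ m = 1 -> n = 0 /\ m = 0) :
  exists rho : algE q1 q2 q3 -> fock R[i] -> fock R[i],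
    [/\ is_module rho,
        forall lam : Pplus,
          [/\ fock_lim (fun N => W_e q1 q3 u (trunc N lam))
                       (fun n => rho (E_e q1 q2 q3 n) << lam >>),
              fock_lim (fun N => W_fN q1 q2 q3 u (trunc N lam))
                       (fun n => rho (E_f q1 q2 q3 n) << lam >>),
              fock_lim (fun N => W_psipN q1 q2 q3 u (trunc N lam))
                       (fun n => rho (E_psip q1 q2 q3 n) << lam >>)
            & fock_lim (fun N => W_psimN q1 q2 q3 u (trunc N lam))
                       (fun n => rho (E_psim q1 q2 q3 n) << lam >>)]
      & has_level rho 1 q2].
Proof.
by apply: fock_space_module => //; rewrite pnatr_eq0.
Qed.
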